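(* Let $(\bar\lambda_h,\bar u_h)$ be an exact eigenpair ($\bar\lambda_h<\infty$) of the WG eigenvalue problem $a_h(\bar u_h,v_h)=\bar\lambda_hb_h(\bar u_h,v_h)$ for all $v_h\in V_h$. Let $(\lambda_{i,h}^{(\ell)},u_{i,h}^{(\ell)})$, $\ell\ge1$, be produced by the augmented subspace method for one eigenpair described in the context, and assume that for each $\ell$ the value $\mu_{i,h}^{(\ell)}=1/\lambda_{i,h}^{(\ell)}$ is the closest to $\bar\mu_h=1/\bar\lambda_h$ among the values $\mu_{j,h}^{(\ell)}=1/\lambda_{j,h}^{(\ell)}$. Let $E_{i,h}^{(\ell)}:V_h\to{\rm span}\{u_{i,h}^{(\ell)}\}$ be the spectral projector defined by $a_h(E_{i,h}^{(\ell)}w,u_{i,h}^{(\ell)})=a_h(w,u_{i,h}^{(\ell)})$ for $w\in V_h$, and let $$\delta_{\lambda,h}^{(\ell)}=\min_{j\ne i}\left|\frac1{\lambda_{j,h}^{(\ell)}}-\frac1{\bar\lambda_h}\right|,$$ which are assumed to be positive. Then for every $\ell\ge 1$, $$\left\|\bar u_h-E_{i,h}^{(\ell+1)}\bar u_h\right\|_{a,h}\le\bar\lambda_h\sqrt{1+\frac{\eta_a^2(W_H)}{\bar\lambda_{1,h}\big(\delta_{\lambda,h}^{(\ell+1)}\big)^2}}\left(1+\frac1{\bar\lambda_{1,h}\delta_{\lambda,h}^{(\ell)}}\right)\eta_a^2(W_H)\left\|\bar u_h-E_{i,h}^{(\ell)}\bar u_h\right\|_{a,h}.$$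
   Context: Setting. $\Omega\subset\mathbb R^d$ ($d=2,3$) is a convex bounded polygonal or polyhedral domain, $A\in[L^\infty(\Omega)]^{d\times d}$ is symmetric and satisfies $c\,\xi^T\xi\le\xi^TA(x)\xi\le C\,\xi^T\xi$ for all $\xi\in\mathbb R^d$, $x\in\Omega$, with positive constants $c,C$. Weak Galerkin (WG) space. $\mathcal T_h$ is a shape-regular, quasi-uniform mesh of $\Omega$ by triangles/tetrahedra with edges/faces $\mathcal E_h$ and mesh size $h$. Fix an integer $r\ge 0$ and $t\in\{r,r+1\}$. $V_h$ is the space of $v=\{v_0,v_b\}$ with $v_0|_K\in\mathcal P_r(K)$ for each $K\in\mathcal T_h$, $v_b|_e\in\mathcal P_t(e)$ (single-valued) for each $e\in\mathcal E_h$, and $v_b|_e=0$ for $e\subset\partial\Omega$; no continuity between $v_0$ and $v_b$ is required. Set $G_r(K)=[\mathcal P_r(K)]^d+\widehat{\mathcal P}_r(K)\mathbf x$ if $t=r$ (Raviart-Thomas), with $\widehat{\mathcal P}_r(K)$ the homogeneous polynomials of degree $r$, and $G_r(K)=[\mathcal P_{r+1}(K)]^d$ if $t=r+1$ (BDM). The discrete weak gradient $\nabla_w v$ of $v\in V_h$ is defined on each $K$ by $\nabla_wv|_K\in G_r(K)$ and $(\nabla_wv,\mathbf q)_K=-(v_0,\nabla\cdot\mathbf q)_K+\langle v_b,\mathbf q\cdot\mathbf n\rangle_{\partial K}$ for all $\mathbf q\in G_r(K)$. Put $a_h(u,v)=\sum_{K}(A\nabla_wu,\nabla_wv)_K$,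 $b_h(u,v)=\sum_K(u_0,v_0)_K$, $\|v\|_{a,h}=\sqrt{a_h(v,v)}$, $\|v\|_{b,h}=\sqrt{b_h(v,v)}$. For $f\in L^2(\Omega)$, $b_h(f,v)=(f,v_0)_{L^2(\Omega)}$ and $\|f\|_{b,h}=\|f\|_{L^2(\Omega)}$. Discrete eigenvalue problem. The eigenvalues of the WG problem are ordered $0<\bar\lambda_{1,h}\le\cdots\le\bar\lambda_{N_h,h}$, $N_h=\dim V_h$, with $a_h$-orthonormal eigenfunctions. Since $b_h$ is only positive semidefinite, eigenpairs here and on subspaces of $V_h$ are understood in the form $b_h(u,v)=\mu\,a_h(u,v)$ with $\lambda=1/\mu$, where $\lambda=+\infty$ and $1/\lambda=0$ if $\mu=0$. Coarse space. $\mathcal T_H$ is a coarse mesh of size $H$, $\mathcal T_h$ is nested in $\mathcal T_H$, $W_H$ (dimension $N_H$) is the conforming linear finite element space on $\mathcal T_H$ (zero on $\partial\Omega$), and it is assumed that $W_H\subset V_h$, with $w$ identified with $\{w|_K,w|_e\}$. Let $T_h:L^2(\Omega)\to V_h$ be given by $a_h(T_hf,v)=b_h(f,v)$ for all $v\in V_h$, and $$\eta_a(W_H)=\sup_{f\in L^2(\Omega),\ \|f\|_{b,h}=1}\ \inf_{w_H\in W_H}\|T_hf-w_H\|_{a,h}.$$ Augmented subspace method for one eigenpair. Start from a given function $\widehat u_{i,h}^{(1)}\in V_h$. For each $\ell\ge1$ let $V_{H,h}^{(\ell)}=W_H+{\rm span}\{\widehat u_{i,h}^{(\ell)}\}$,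 with $N_{H,h}=\dim V_{H,h}^{(\ell)}=N_H+1$. Let $(\lambda_{j,h}^{(\ell)},u_{j,h}^{(\ell)})$, $1\le j\le N_{H,h}$, be all eigenpairs, in nondecreasing order, of $a_h(u,v)=\lambda b_h(u,v)$ for all $v\in V_{H,h}^{(\ell)}$, $u\in V_{H,h}^{(\ell)}$, with $a_h(u_{p,h}^{(\ell)},u_{q,h}^{(\ell)})=\delta_{pq}$. One eigenpair with finite eigenvalue, written $(\lambda_{i,h}^{(\ell)},u_{i,h}^{(\ell)})$, is selected (for $\ell\ge2$, the one whose eigenfunction has the largest component in ${\rm span}\{\widehat u_{i,h}^{(\ell)}\}$); here $i$ denotes the position of the selected eigenpair in the list on $V_{H,h}^{(\ell)}$ (it may depend on $\ell$), and $\min_{j\ne i}$ runs over the other indices $1\le j\le N_{H,h}$. Then $\widehat u_{i,h}^{(\ell+1)}\in V_h$ solves $a_h(\widehat u_{i,h}^{(\ell+1)},v_h)=\lambda_{i,h}^{(\ell)}b_h(u_{i,h}^{(\ell)},v_h)$ for all $v_h\in V_h$, and one repeats with $\ell+1$. *)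

(* Defs.v *)
From HB Require Import structures.
From mathcomp Require Import all_boot all_order all_algebra.
From mathcomp Require mpoly.

Set Implicit Arguments.
Unset Strict Implicit.
Unset Printing Implicit Defensive.

(* The notations of [mpoly] clash with those of the analysis library: they are
   only imported inside this module, before that library is loaded. *)
Module Polynomials.
Import mpoly GRing.Theory.
Local Open Scope ring_scope.

Section Polynomials.
Variables (R : comNzRingType) (n : nat).

Definition peval (p : {mpoly R[n]}) (x : 'rV[R]_n) : R :=
  p.@[fun i => x 0 i].

(* [msize p] is 1 + the total degree of [p]. *)
Definition deg_le (k : nat) (p : {mpoly R[n]}) : Prop := (msize p <= k.+1)%N.

Definition pvec := 'I_n -> {mpoly R[n]}.

Definition pvec_eval (q : pvec) (x : 'rV[R]_n) : 'rV[R]_n :=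
  \row_i peval (q i) x.

Definition pvec_div (q : pvec) : {mpoly R[n]} := \sum_(i < n) (q i)^`M(i).

Definition in_RT (r : nat) (q : pvec) : Prop :=
  exists (p : pvec) (s : {mpoly R[n]}),
    [/\ forall i, deg_le r (p i), s \is r.-homog &
        forall i, q i = p i + s * 'X_i].

Definition in_BDM (r : nat) (q : pvec) : Prop := forall i, deg_le r.+1 (q i).

Definition in_G (r t : nat) (q : pvec) : Prop :=
  if t == r then in_RT r q else in_BDM r q.

End Polynomials.
End Polynomials.

From mathcomp Require Import all_classical all_reals all_analysis.
Import Order.TTheory GRing.Theory Num.Theory.
Import numFieldNormedType.Exports.
Import Polynomials.
Local Open Scope classical_set_scope.
Local Open Scope ring_scope.

Definition rv_display : measure_display.
Proof. exact: default_measure_display. Qed.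

Section rv_measurable.
Variables (R : realType) (n : nat).

Let coord : 'I_n -> 'rV[R]_n -> R := fun i x => x 0 i.

Let rv0 : g_sigma_preimage coord set0.
Proof. exact: sigma_algebra0. Qed.

Let rvC A : g_sigma_preimage coord A -> g_sigma_preimage coord (~` A).
Proof. exact: sigma_algebraC. Qed.

Let rvU (F : _^nat) : (forall i, g_sigma_preimage coord (F i)) ->
  g_sigma_preimage coord (\bigcup_i (F i)).
Proof. exact: sigma_algebra_bigcup. Qed.

(* The product sigma-algebra on R^n, generated by the coordinates. *)
HB.instance Definition _ := @isMeasurable.Build rv_display
  'rV[R]_n (g_sigma_preimage coord) rv0 rvC rvU.

End rv_measurable.

Section lebesgue_rv.
Variable R : realType.

Lemma measurable_coord n (i : 'I_n) :
  measurable_fun [set: 'rV[R]_n] (fun x : 'rV[R]_n => x 0 i).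
Proof.
move=> _ Y mY; rewrite setTI; apply: sub_sigma_algebra => /=.
rewrite -bigcup_seq/=; exists i => /=; first by rewrite mem_index_enum.
by exists Y => //; rewrite setTI.
Qed.

Lemma measurable_to_rv d (T : measurableType d) n (f : T -> 'rV[R]_n) :
  (forall i, measurable_fun [set: T] (fun x => f x 0 i)) ->
  measurable_fun [set: T] f.
Proof.
move=> mf _ A mA.
have sub : g_sigma_preimage (fun i x => f x 0 i) `<=` (@measurable _ T).
  apply: smallest_sub; first exact: sigma_algebra_measurable.
  clear A mA; case: n => [|n] in f mf *; first by rewrite big_ord0.
  rewrite -bigcup_mkord_ord; apply: bigcup_sub => i Ii.
  by move=> B [C mC <-]; exact: mf.
by apply: sub; rewrite (g_sigma_preimage_comp (fun i (x : 'rV[R]_n) => x 0 i)); exists A.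
Qed.

Definition rv_cons n (z : measurableTypeR R * 'rV[R]_n) : 'rV[R]_n.+1 :=
  \row_i oapp (fun j => z.2 0 j) (z.1 : R) (unlift ord0 i).

Definition rv_uncons n (x : 'rV[R]_n.+1) : measurableTypeR R * 'rV[R]_n :=
  (x 0 0, \row_j x 0 (lift ord0 j)).

Lemma rv_consK n : cancel (@rv_cons n) (@rv_uncons n).
Proof.
move=> [x v]; congr pair; first by rewrite mxE unlift_none.
by apply/rowP => j; rewrite !mxE liftK.
Qed.

Lemma measurable_rv_cons n : measurable_fun [set: _] (@rv_cons n).
Proof.
apply: measurable_to_rv => i; rewrite /rv_cons.
under eq_fun do rewrite mxE.
case: (unlift ord0 i) => [j|] /=; last exact: measurable_fst.
by apply: (@measurableT_comp _ _ _ _ _ _ (fun v : 'rV[R]_n => v 0 j) _ snd);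
  [exact: measurable_coord|exact: measurable_snd].
Qed.

Lemma measurable_rv_uncons n : measurable_fun [set: _] (@rv_uncons n).
Proof.
apply: measurable_fun_pair; first exact: measurable_coord.
apply: measurable_to_rv => i /=.
by under eq_fun do rewrite mxE; exact: measurable_coord.
Qed.

HB.instance Definition _ n :=
  isMeasurableFun.Build _ _ _ _ (@rv_cons n) (@measurable_rv_cons n).

Section lebesgue_step.
Variables (n : nat) (mu : {sigma_finite_measure set 'rV[R]_n -> \bar R}).

Definition lebesgue_step : set 'rV[R]_n.+1 -> \bar R :=
  pushforward (@lebesgue_measure R \x mu)%E (@rv_cons n).

Let lebesgue_step0 : lebesgue_step set0 = 0%E.
Proof. by rewrite /lebesgue_step /pushforward preimage_set0 measure0. Qed.

Let lebesgue_step_ge0 A : (0 <= lebesgue_step A)%E.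
Proof. exact: measure_ge0. Qed.

Let lebesgue_step_sigma_additive : semi_sigma_additive lebesgue_step.
Proof.
move=> F mF tF mUF; rewrite /lebesgue_step /pushforward preimage_bigcup.
apply: measure_semi_sigma_additive.
- by move=> k; rewrite -[X in measurable X]setTI; exact: measurable_rv_cons.
- apply/trivIsetP => /= i j _ _ ij; rewrite -preimage_setI.
  by move/trivIsetP : tF => /(_ _ _ _ _ ij) ->//; rewrite preimage_set0.
- rewrite -preimage_bigcup -[X in measurable X]setTI.
  exact: measurable_rv_cons.
Qed.

HB.instance Definition _ := isMeasure.Build _ _ _ lebesgue_step
  lebesgue_step0 lebesgue_step_ge0 lebesgue_step_sigma_additive.

Let lebesgue_step_sigma_finite : sigma_finite setT lebesgue_step.
Proof.
have /sigma_finiteP[F [FT ndF Foo]] := sigma_finiteT (@lebesgue_measure R).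
have /sigma_finiteP[G [GT ndG Goo]] := sigma_finiteT mu.
exists (fun k => @rv_uncons n @^-1` (F k `*` G k)).
  rewrite -preimage_bigcup (_ : \bigcup_k _ = setT) ?preimage_setT //.
  rewrite -subTset => -[x y] _.
  have [k _ Fkx] : (\bigcup_i F i) x by rewrite -FT.
  have [l _ Gly] : (\bigcup_i G i) y by rewrite -GT.
  exists (maxn k l) => //; split.
    by move: x Fkx; exact/subsetPset/ndF/leq_maxl.
  by move: y Gly; exact/subsetPset/ndG/leq_maxr.
move=> k; have [mF Fk] := Foo k; have [mG Gk] := Goo k; split.
  rewrite -[X in measurable X]setTI; apply: measurable_rv_uncons => //.
  exact: measurableX.
rewrite /lebesgue_step /pushforward -comp_preimage.
rewrite (_ : _ \o _ = id); last by apply/funext => z /=; rewrite rv_consK.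
by rewrite preimage_id product_measure1E// lte_mul_pinfty// ge0_fin_numE.
Qed.

HB.instance Definition _ := Measure_isSigmaFinite.Build _ _ _ lebesgue_step
  lebesgue_step_sigma_finite.

End lebesgue_step.

(* Lebesgue measure on R^n (on Borel sets), as an iterated product measure. *)
Fixpoint lebesgue_rv n : {sigma_finite_measure set 'rV[R]_n -> \bar R} :=
  if n is n'.+1 then lebesgue_step (lebesgue_rv n') else \d_(0 : 'rV[R]_0).

End lebesgue_rv.

Section geometry.
Variable R : realType.

Definition dot n (x y : 'rV[R]_n) : R := \sum_i x 0 i * y 0 i.

(* The library norm on ['rV[R]_n] is the sup norm. *)
Definition enorm n (x : 'rV[R]_n) : R := Num.sqrt (dot x x).

(* Nonempty bounded intersection of finitely many open half-spaces. *)
Definition convex_polyhedral_domain n (Omega : set 'rV[R]_n) : Prop :=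
  [/\ Omega !=set0, bounded_set Omega &
      exists m (N : 'I_m -> 'rV[R]_n) (c : 'I_m -> R),
        Omega = [set x | forall k, dot (N k) x < c k]].

Definition boundary n (Omega : set 'rV[R]_n) : set 'rV[R]_n :=
  closure Omega `\` Omega°.

(* A simplex is given by its family of vertices [P]. *)
Definition csimplex k n (P : 'I_k -> 'rV[R]_n) : set 'rV[R]_n :=
  [set x | exists t : 'I_k -> R,
    [/\ forall i, 0 <= t i, \sum_i t i = 1 & x = \sum_i t i *: P i]].

Definition osimplex k n (P : 'I_k -> 'rV[R]_n) : set 'rV[R]_n :=
  [set x | exists t : 'I_k -> R,
    [/\ forall i, 0 < t i, \sum_i t i = 1 & x = \sum_i t i *: P i]].

Definition subsimplex k n (P : 'I_k -> 'rV[R]_n) (I : {set 'I_k}) :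
    set 'rV[R]_n :=
  [set x | exists t : 'I_k -> R,
    [/\ forall i, 0 <= t i, forall i, i \notin I -> t i = 0,
        \sum_i t i = 1 & x = \sum_i t i *: P i]].

(* The face opposite to the vertex [i]. *)
Definition face k n (P : 'I_k.+1 -> 'rV[R]_n) (i : 'I_k.+1) :
    'I_k -> 'rV[R]_n := fun j => P (lift i j).

Definition edge_mx k n (P : 'I_k.+1 -> 'rV[R]_n) : 'M[R]_(k, n) :=
  \matrix_(j < k) (P (lift ord0 j) - P ord0).

Definition outward_unit_normal k n (P : 'I_k -> 'rV[R]_n) (i : 'I_k) :
    'rV[R]_n :=
  xget 0 [set nu | [/\ dot nu nu = 1,
    forall j l, j != i -> l != i -> dot nu (P j - P l) = 0 &
    forall j, j != i -> dot nu (P i - P j) < 0]].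

Definition std_simplex k : set 'rV[R]_k :=
  [set x | (forall i, 0 < x 0 i) /\ \sum_i x 0 i < 1].

(* The k-dimensional surface integral of [g] over the simplex with vertices
   [P], through the affine parametrization by the standard simplex, whose area
   element is the square root of the Gram determinant. *)
Definition simplex_integral k n (P : 'I_k.+1 -> 'rV[R]_n)
    (g : 'rV[R]_n -> R) : R :=
  Num.sqrt (\det (edge_mx P *m (edge_mx P)^T)) *
  \int[lebesgue_rv R k]_(x in @std_simplex k) g (P ord0 + x *m edge_mx P).

Definition diam n (K : set 'rV[R]_n) : R :=
  sup [set r | exists x y, [/\ K x, K y & r = enorm (x - y)]].

Section mesh.
Variable n : nat.
(* The space dimension is n.+1. *)
Local Notation Rd := 'rV[R]_n.+1.

Definition mesh m := 'I_m -> 'I_n.+2 -> Rd.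

(* Conforming simplicial triangulation; with [I] empty, [subsimplex] is the
   empty set. *)
Definition triangulation m (Omega : set Rd) (T : mesh m) : Prop :=
  [/\ forall k, row_free (edge_mx (T k)),
      closure Omega = \bigcup_k csimplex (T k),
      forall k l, k != l -> osimplex (T k) `&` osimplex (T l) = set0 &
      forall k l, k != l -> exists I J,
        csimplex (T k) `&` csimplex (T l) = subsimplex (T k) I /\
        subsimplex (T k) I = subsimplex (T l) J].

Definition mesh_size m (T : mesh m) : R :=
  \big[Num.max/0]_k diam (csimplex (T k)).

(* h_K <= sigma * rho with rho the diameter of a ball inscribed in K. *)
Definition shape_regular m (sigma : R) (T : mesh m) : Prop :=
  forall k, exists x rho,
    [/\ 0 < rho, [set y | enorm (y - x) <= rho / 2] `<=` csimplex (T k) &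
        diam (csimplex (T k)) <= sigma * rho].

Definition quasi_uniform m (sigma : R) (T : mesh m) : Prop :=
  forall k, mesh_size T <= sigma * diam (csimplex (T k)).

Definition nested m M (T : mesh m) (T' : mesh M) : Prop :=
  forall k, exists l, csimplex (T k) `<=` csimplex (T' l).

Definition cells m (T : mesh m) : set Rd := \bigcup_k osimplex (T k).

Definition faces m (T : mesh m) : set Rd :=
  [set x | exists k i, osimplex (face (T k) i) x].

End mesh.
End geometry.

Section linear_algebra.
Variables (R : realType) (V : lmodType R).

Definition has_dim (W : set V) (N : nat) : Prop :=
  exists e : 'I_N -> V,
    [/\ forall i, W (e i),
        forall c : 'I_N -> R, \sum_i c i *: e i = 0 -> forall i, c i = 0 &
        forall v, W v -> exists c : 'I_N -> R, v = \sum_i c i *: e i].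

Definition add_span (W : set V) (u : V) : set V :=
  [set v | exists w c, W w /\ v = w + c *: u].

(* 1 / mu, with the convention 1 / 0 = +oo. *)
Definition recip (mu : R) : \bar R :=
  if mu == 0 then +oo%E else (mu^-1)%:E.

(* 1 / lam, with the convention 1 / (+oo) = 0. *)
Definition erecip (lam : \bar R) : R := if lam is l%:E then l^-1 else 0.

(* a u v = lam b u v on W, understood as b u v = mu a u v with lam = 1 / mu. *)
Definition eigenpair (a b : V -> V -> R) (W : set V) (lam : \bar R) (u : V) :
    Prop :=
  [/\ W u, u != 0 &
      exists mu, lam = recip mu /\ forall v, W v -> b u v = mu * a u v].

(* Eigenpairs are numbered from 1 to N. *)
Definition eigensystem (a b : V -> V -> R) (W : set V) (N : nat)
    (lam : nat -> \bar R) (u : nat -> V) : Prop :=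
  [/\ forall j, (1 <= j <= N)%N -> eigenpair a b W (lam j) (u j),
      forall p q, (1 <= p <= N)%N -> (1 <= q <= N)%N ->
        a (u p) (u q) = (p == q)%:R &
      forall p q, (1 <= p)%N -> (p <= q)%N -> (q <= N)%N ->
        (lam p <= lam q)%E].

Definition form_norm (a : V -> V -> R) (u : V) : R := Num.sqrt (a u u).

End linear_algebra.

Section weak_galerkin.
Variables (R : realType) (n : nat).
Local Notation Rd := 'rV[R]_n.+1.
Local Notation leb := (lebesgue_rv R n.+1).

Definition coefficient (Omega : set Rd) (A : Rd -> 'M[R]_n.+1) (c C : R) :
    Prop :=
  [/\ forall i j, measurable_fun Omega (fun x => A x i j),
      exists M, forall i j, {ae leb, forall x, Omega x -> `|A x i j| <= M},
      forall x, Omega x -> (A x)^T = A x,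
      0 < c /\ 0 < C &
      forall x (xi : 'cV[R]_n.+1), Omega x ->
        c * (xi^T *m xi) 0 0 <= (xi^T *m A x *m xi) 0 0 /\
        (xi^T *m A x *m xi) 0 0 <= C * (xi^T *m xi) 0 0].

Definition L2 (Omega : set Rd) (f : Rd -> R) : Prop :=
  measurable_fun Omega f /\
  leb.-integrable Omega (fun x => (f x ^+ 2)%:E).

Definition L2norm (Omega : set Rd) (f : Rd -> R) : R :=
  Num.sqrt (\int[leb]_(x in Omega) (f x ^+ 2)).

Definition poly_on (k : nat) (S : set Rd) (f : Rd -> R) : Prop :=
  exists p, deg_le k p /\ forall x, S x -> f x = peval p x.

(* A weak function is a pair {v_0, v_b} of functions on R^d: v_0 is carried by
   the open cells and v_b by the relatively open faces. Both vanish elsewhere,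
   so that distinct elements of V_h are distinct functions. *)
Definition wfun : lmodType R := ((Rd -> R^o) * (Rd -> R^o))%type.

Definition WG_space m (Omega : set Rd) (T : mesh R n m) (r t : nat) :
    set wfun :=
  [set v | [/\ forall k, poly_on r (osimplex (T k)) v.1,
      forall x, ~ cells T x -> v.1 x = 0,
      forall k i, poly_on t (osimplex (face (T k) i)) v.2,
      forall k i, osimplex (face (T k) i) `<=` boundary Omega ->
        forall x, osimplex (face (T k) i) x -> v.2 x = 0 &
      forall x, ~ faces T x -> v.2 x = 0]].

Definition weak_gradient m (T : mesh R n m) (r t : nat) (v : wfun)
    (g : Rd -> Rd) : Prop :=
  forall k,
    (exists q, in_G r t q /\ forall x, osimplex (T k) x -> g x = pvec_eval q x)
    /\
    forall q, in_G r t q ->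
      \int[leb]_(x in osimplex (T k)) dot (g x) (pvec_eval q x) =
      (- (\int[leb]_(x in osimplex (T k)) (v.1 x * peval (pvec_div q) x)))
      + \sum_i simplex_integral (face (T k) i) (fun x =>
          v.2 x * dot (pvec_eval q x) (outward_unit_normal (T k) i)).

Definition a_h m (T : mesh R n m) (A : Rd -> 'M[R]_n.+1)
    (gradw : wfun -> Rd -> Rd) (u v : wfun) : R :=
  \sum_k \int[leb]_(x in osimplex (T k))
    (gradw v x *m (A x *m (gradw u x)^T)) 0 0.

Definition b_h m (T : mesh R n m) (u v : wfun) : R :=
  \sum_k \int[leb]_(x in osimplex (T k)) (u.1 x * v.1 x).

Definition b_h_L2 (Omega : set Rd) (f : Rd -> R) (v : wfun) : R :=
  \int[leb]_(x in Omega) (f x * v.1 x).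

(* Functions are extended by zero outside of Omega; together with continuity,
   this encodes the boundary condition. *)
Definition FE_space M (Omega : set Rd) (T : mesh R n M) : set (Rd -> R) :=
  [set w | [/\ continuous w, forall x, ~ Omega x -> w x = 0 &
      forall k, poly_on 1 (csimplex (T k)) w]].

(* w is identified with {w|_K, w|_e}. *)
Definition embed m (T : mesh R n m) (w : Rd -> R) : wfun :=
  (patch (fun=> 0) (cells T) w, patch (fun=> 0) (faces T) w).

Definition eta_a (Omega : set Rd) (a : wfun -> wfun -> R)
    (Th : (Rd -> R) -> wfun) (W : set wfun) : R :=
  sup [set s | exists f, [/\ L2 Omega f, L2norm Omega f = 1 &
    s = inf [set form_norm a (Th f - w) | w in W]]].

(* Minimum over j != i, 1 <= j <= N; it is +oo if there is no such j. *)
Definition spectral_gap (N i : nat) (lam : nat -> \bar R) (lamb : R) : \bar R :=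
  \big[Order.min/+oo%E]_(1 <= j < N.+1 | j != i)
    (`|erecip (lam j) - lamb^-1|)%:E.

(* Among the eigenpairs with finite eigenvalue, the [i]-th one has the largest
   component along [u] in the decomposition W + span{u}. *)
Definition largest_component (W : set wfun) (u : wfun) (N i : nat)
    (lam : nat -> \bar R) (e : nat -> wfun) : Prop :=
  forall j, (1 <= j <= N)%N -> (lam j < +oo)%E ->
  forall w c w' c', W w -> W w' ->
    e i = w + c *: u -> e j = w' + c' *: u -> `|c'| <= `|c|.

End weak_galerkin.

(* Main.v *)
(* Write mu = 1/lambda, P for the a_h-orthogonal projection onto the augmented
   space and eta for eta_a(W_H).  Since (mub - mu_j) a(ub, u_j) = b(ub - P ub, u_j),
   the spectral gap bounds P ub - E ub by ub - P ub, in the a- and the b-norm, and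
   by Aubin-Nitsche duality |ub - P ub|_b <= eta |ub - P ub|_a.  Subtracting from ub
   the multiple lambda_b T_h(E ub) of the new function uhat leaves
   lambda_b T_h(ub - E ub), whose distance to W_H is at most
   lambda_b eta |ub - E ub|_b; this bounds |ub - P ub|_a for the next space. *)

Require Import Defs.
From mathcomp Require Import all_boot all_order all_algebra.
From mathcomp Require Import ring lra measurable_realfun.
From mathcomp Require Import (canonicals, coercions) mpoly.
From mathcomp Require Import all_classical all_reals all_analysis.
Import Order.TTheory GRing.Theory Num.Theory.
Import numFieldNormedType.Exports.
Import Polynomials.
Local Open Scope classical_set_scope.
Local Open Scope ring_scope.

Set Implicit Arguments.
Unset Strict Implicit.
Unset Printing Implicit Defensive.

(** * Rayleigh-Ritz projections for a pair of semidefinite forms *)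

Section forms.
Context {R : realType} {V : lmodType R}.

Definition linear_subspace (S : set V) : Prop :=
  S 0 /\ forall k u v, S u -> S v -> S (k *: u + v).

(* The forms [a_h] and [b_h] are bilinear on [V_h] only: outside [V_h] the weak
   gradient is arbitrary, and the integrals need not exist. *)
Record psd_form (S : set V) (f : V -> V -> R) : Prop := PsdForm {
  form_linl : forall k u v w, S u -> S v -> S w ->
    f (k *: u + v) w = k * f u w + f v w;
  form_sym : forall u v, S u -> S v -> f u v = f v u;
  form_ge0 : forall u, S u -> 0 <= f u u }.

Section linear_subspace_theory.
Variable S : set V.
Hypothesis hS : linear_subspace S.

Lemma linear_subspaceZ k u : S u -> S (k *: u).
Proof. by case: hS => S0 SL Su; rewrite -[_ *: _]addr0; exact: SL. Qed.

Lemma linear_subspaceD u v : S u -> S v -> S (u + v).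
Proof. by case: hS => _ SL Su Sv; rewrite -[u]scale1r; exact: SL. Qed.

Lemma linear_subspaceB u v : S u -> S v -> S (u - v).
Proof.
by move=> Su Sv; apply: linear_subspaceD => //; rewrite -scaleN1r;
  exact: linear_subspaceZ.
Qed.

Lemma linear_subspace_sum N (c : 'I_N -> R) (e : 'I_N -> V) (P : pred 'I_N) :
  (forall j, S (e j)) -> S (\sum_(j | P j) c j *: e j).
Proof.
move=> Se; elim/big_ind: _ => //; first by case: hS.
  exact: linear_subspaceD.
by move=> j _; exact: linear_subspaceZ.
Qed.

Variable f : V -> V -> R.
Hypothesis hf : psd_form S f.

Lemma psdDl u v w : S u -> S v -> S w -> f (u + v) w = f u w + f v w.
Proof. by move=> *; rewrite -[u]scale1r (form_linl hf) ?mul1r ?scale1r. Qed.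

Lemma psd0l w : S w -> f 0 w = 0.
Proof.
case: hS => S0 _ Sw; have := psdDl S0 S0 Sw.
by rewrite addr0; lra.
Qed.

Lemma psdZl k u w : S u -> S w -> f (k *: u) w = k * f u w.
Proof.
case: hS => S0 _ Su Sw.
by rewrite -[_ *: _]addr0 (form_linl hf) // psd0l // addr0.
Qed.

Lemma psdBl u v w : S u -> S v -> S w -> f (u - v) w = f u w - f v w.
Proof.
move=> Su Sv Sw; rewrite -scaleN1r psdDl ?psdZl ?mulN1r //.
exact: linear_subspaceZ.
Qed.

Lemma psdZr k u w : S u -> S w -> f w (k *: u) = k * f w u.
Proof.
move=> Su Sw; have SkU := linear_subspaceZ k Su.
by rewrite (form_sym hf Sw SkU) psdZl // (form_sym hf Su Sw).
Qed.

Lemma psdDr u v w : S u -> S v -> S w -> f w (u + v) = f w u + f w v.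
Proof.
move=> Su Sv Sw; rewrite (form_sym hf Sw (linear_subspaceD Su Sv)).
by rewrite psdDl // (form_sym hf Su Sw) (form_sym hf Sv Sw).
Qed.

Lemma form_suml N (c : 'I_N -> R) (e : 'I_N -> V) (P : pred 'I_N) w :
  (forall j, S (e j)) -> S w ->
  f (\sum_(j | P j) c j *: e j) w = \sum_(j | P j) c j * f (e j) w.
Proof.
move=> Se Sw; pose K x y := S x /\ f x w = y.
suff [] : K (\sum_(j | P j) c j *: e j) (\sum_(j | P j) c j * f (e j) w) by [].
apply: big_ind2; first by split; [case: hS|exact: psd0l].
  move=> x1 x2 y1 y2 [Sx1 <-] [Sy1 <-]; split; first exact: linear_subspaceD.
  exact: psdDl.
by move=> j _; split; [exact: linear_subspaceZ|exact: psdZl].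
Qed.

Lemma form_sumr N (c : 'I_N -> R) (e : 'I_N -> V) (P : pred 'I_N) w :
  (forall j, S (e j)) -> S w ->
  f w (\sum_(j | P j) c j *: e j) = \sum_(j | P j) c j * f w (e j).
Proof.
move=> Se Sw; rewrite (form_sym hf Sw (linear_subspace_sum _ _ Se)) form_suml //.
by apply: eq_bigr => j _; rewrite (form_sym hf (Se j) Sw).
Qed.

Lemma psdDD u v : S u -> S v ->
  f (u + v) (u + v) = f u u + 2 * f u v + f v v.
Proof.
move=> Su Sv; have SD := linear_subspaceD Su Sv.
by rewrite psdDl // !psdDr // (form_sym hf Sv Su); ring.
Qed.

Lemma form_cauchy_schwarz u v : S u -> S v -> f u v ^+ 2 <= f u u * f v v.
Proof.
move=> Su Sv.
have quad t : 0 <= f u u + 2 * t * f u v + t ^+ 2 * f v v.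
  have Stv := linear_subspaceZ t Sv.
  have := form_ge0 hf (linear_subspaceD Su Stv).
  by rewrite psdDD // !psdZr ?psdZl //; congr (0 <= _); ring.
have [vv0|vv0] := eqVneq (f v v) 0; last first.
  have vv : 0 < f v v by rewrite lt_def vv0 (form_ge0 hf).
  have := quad (- f u v / f v v); rewrite -(pmulr_rge0 _ vv).
  rewrite [X in 0 <= X -> _](_ : _ = f u u * f v v - f u v ^+ 2); last by field.
  by rewrite subr_ge0.
rewrite vv0 mulr0; have [->|uv0] := eqVneq (f u v) 0; first by rewrite expr0n.
have := quad (- (f u u + 1) / (2 * f u v)); rewrite vv0 mulr0 addr0.
rewrite [X in 0 <= X -> _](_ : _ = -1) ?ler0N1 //.
by field.
Qed.

Lemma form_triangle u v : S u -> S v ->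
  Num.sqrt (f (u + v) (u + v)) <= Num.sqrt (f u u) + Num.sqrt (f v v).
Proof.
move=> Su Sv; have fu := form_ge0 hf Su; have fv := form_ge0 hf Sv.
rewrite -[leRHS]ger0_norm ?addr_ge0 ?sqrtr_ge0 // -sqrtr_sqr ler_sqrt ?sqr_ge0 //.
rewrite psdDD // sqrrD !sqr_sqrtr // lerD2r lerD2l mulr_natl lerMn2r //=.
rewrite -sqrtrM //; apply: le_trans (ler_norm _) _.
by rewrite -sqrtr_sqr; apply: ler_wsqrtr; exact: form_cauchy_schwarz.
Qed.

End linear_subspace_theory.

Section projection.
Variables (S : set V) (a : V -> V -> R) (N : nat) (e : 'I_N -> V).
Hypotheses (hS : linear_subspace S) (ha : psd_form S a) (Se : forall j, S (e j)).
Hypothesis orth : forall p q, a (e p) (e q) = (p == q)%:R.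

Definition in_span (y : V) : Prop := exists c : 'I_N -> R, y = \sum_j c j *: e j.

Definition proj (x : V) : V := \sum_j a x (e j) *: e j.

Lemma in_spanD y z : in_span y -> in_span z -> in_span (y + z).
Proof.
move=> [c ->] [c' ->]; exists (fun j => c j + c' j).
by rewrite -big_split /=; apply: eq_bigr => j _; rewrite scalerDl.
Qed.

Lemma in_spanZ k y : in_span y -> in_span (k *: y).
Proof.
move=> [c ->]; exists (fun j => k * c j).
by rewrite scaler_sumr; apply: eq_bigr => j _; rewrite scalerA.
Qed.

Lemma in_spanB y z : in_span y -> in_span z -> in_span (y - z).
Proof.
by move=> hy hz; rewrite -scaleN1r; apply: in_spanD => //; exact: in_spanZ.
Qed.

Lemma in_span_gen j : in_span (e j).
Proof.
exists (fun k => (k == j)%:R); rewrite (bigD1 j) //= eqxx scale1r big1 ?addr0 //.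
by move=> k /negbTE ->; rewrite scale0r.
Qed.

Lemma in_span_proj x : in_span (proj x).
Proof. by exists (fun j => a x (e j)). Qed.

Lemma in_spanS y : in_span y -> S y.
Proof. by move=> [c ->]; exact: linear_subspace_sum. Qed.

Lemma projS x : S (proj x).
Proof. exact: linear_subspace_sum. Qed.

Lemma form_comb (c : 'I_N -> R) j : a (\sum_k c k *: e k) (e j) = c j.
Proof.
rewrite (form_suml hS ha) // (bigD1 j) //= orth eqxx mulr1 big1 ?addr0 // => k.
by move=> /negbTE kj; rewrite orth kj mulr0.
Qed.

Lemma form_comb_sq (c : 'I_N -> R) :
  a (\sum_j c j *: e j) (\sum_j c j *: e j) = \sum_j c j ^+ 2.
Proof.
rewrite (form_sumr hS ha) //; last exact: linear_subspace_sum.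
by apply: eq_bigr => j _; rewrite form_comb.
Qed.

Lemma proj_orth x y : S x -> in_span y -> a (x - proj x) y = 0.
Proof.
move=> Sx [c ->]; rewrite (form_sumr hS ha) //; last exact: linear_subspaceB (projS x).
rewrite big1 // => j _.
by rewrite (psdBl hS ha) // ?form_comb ?subrr ?mulr0 //; exact: projS.
Qed.

Lemma form_sub_span x y : S x -> in_span y ->
  a (x - y) (x - y) =
  a (x - proj x) (x - proj x) + a (proj x - y) (proj x - y).
Proof.
move=> Sx hy; have hz := in_spanB (in_span_proj x) hy.
have Sd := linear_subspaceB hS Sx (projS x).
rewrite -[x - y](subrKA (proj x)) (psdDD hS ha Sd (in_spanS hz)).
by rewrite (proj_orth Sx hz) mulr0 addr0.
Qed.

Lemma proj_best x y : S x -> in_span y ->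
  a (x - proj x) (x - proj x) <= a (x - y) (x - y).
Proof.
move=> Sx hy; rewrite (form_sub_span Sx hy) lerDl (form_ge0 ha) //.
exact/in_spanS/in_spanB/hy/in_span_proj.
Qed.

Variables (b : V -> V -> R) (mu1 eta : R) (W : set V).
Hypotheses (hb : psd_form S b) (mu1_ge0 : 0 <= mu1).
Hypothesis b_le_a : forall v, S v -> b v v <= mu1 * a v v.
Hypothesis eta_ge0 : 0 <= eta.
Hypothesis solvable : forall f, S f ->
  exists g, S g /\ forall v, S v -> a g v = b f v.
Hypothesis approx : forall f g, S f -> S g ->
  (forall v, S v -> a g v = b f v) -> b f f = 1 ->
  forall k, eta < k -> exists w, W w /\ Num.sqrt (a (g - w) (g - w)) < k.
Hypothesis W_span : forall w, W w -> in_span w.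

Lemma approx_proj f g : S f -> S g -> (forall v, S v -> a g v = b f v) ->
  Num.sqrt (a (g - proj g) (g - proj g)) <= eta * Num.sqrt (b f f).
Proof.
move=> Sf Sg gf; have span0 : in_span 0.
  by exists (fun=> 0); rewrite big1 // => j _; rewrite scale0r.
have [ff0|ff0] := eqVneq (b f f) 0.
  have := proj_best Sg span0; rewrite subr0 gf //.
  have := form_cauchy_schwarz hS hb Sf Sg.
  rewrite ff0 mul0r sqrtr0 mulr0 => /(conj (sqr_ge0 (b f g)))/andP/le_anti/esym.
  by move=> /eqP; rewrite sqrf_eq0 => /eqP -> /ler0_sqrtr ->.
have ff : 0 < b f f by rewrite lt_def ff0 (form_ge0 hb).
set s := Num.sqrt (b f f); have s0 : 0 < s by rewrite sqrtr_gt0.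
have s2 : s ^+ 2 = b f f by rewrite sqr_sqrtr // ltW.
rewrite leNgt; apply/negP; set X := Num.sqrt _ => ltX.
have Sf' := linear_subspaceZ hS s^-1 Sf; have Sg' := linear_subspaceZ hS s^-1 Sg.
have gf' v : S v -> a (s^-1 *: g) v = b (s^-1 *: f) v.
  by move=> Sv; rewrite (psdZl hS ha) // (psdZl hS hb) // gf.
have ff' : b (s^-1 *: f) (s^-1 *: f) = 1.
  rewrite (psdZl hS hb) // (psdZr hS hb) // -s2; field.
  exact: lt0r_neq0.
have kX : eta < X / s by rewrite ltr_pdivlMr.
have [w [Ww]] := approx Sf' Sg' gf' ff' kX.
rewrite ltr_pdivlMr // => wX.
have Sw := in_spanS (W_span Ww).
have sw : g - s *: w = s *: (s^-1 *: g - w).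
  by rewrite scalerBr scalerA divff ?scale1r // lt0r_neq0.
have : X <= Num.sqrt (a (s^-1 *: g - w) (s^-1 *: g - w)) * s.
  rewrite -[X in _ * X]gtr0_norm // -sqrtr_sqr -sqrtrM; last first.
    by apply: (form_ge0 ha); exact: linear_subspaceB.
  apply: ler_wsqrtr; apply: le_trans (proj_best Sg (in_spanZ s (W_span Ww))) _.
  have Sgw := linear_subspaceB hS Sg' Sw; have Sgw' := linear_subspaceZ hS s Sgw.
  rewrite sw (psdZl hS ha) // (psdZr hS ha) //.
  by rewrite mulrA -expr2 mulrC.
by rewrite leNgt wX.
Qed.

(* Aubin-Nitsche duality: [x - proj x] is tested against the solution of the
   problem of which it is the right-hand side. *)
Lemma proj_form_le x : S x ->
  Num.sqrt (b (x - proj x) (x - proj x)) <=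
  eta * Num.sqrt (a (x - proj x) (x - proj x)).
Proof.
move=> Sx; have Sd := linear_subspaceB hS Sx (projS x); set d := x - proj x in Sd *.
have [g [Sg gd]] := solvable Sd; have SPg := projS g.
have Sd' := linear_subspaceB hS Sg SPg.
set B := Num.sqrt (b d d); set A := Num.sqrt (a d d).
have A0 : 0 <= A by exact: sqrtr_ge0.
have [->|B0] := eqVneq B 0; first exact: mulr_ge0.
have {}B0 : 0 < B by rewrite lt_def B0 sqrtr_ge0.
have Bdd : B ^+ 2 = a (g - proj g) d.
  rewrite sqr_sqrtr ?(form_ge0 hb) // (psdBl hS ha) // -gd //.
  by rewrite (form_sym ha SPg Sd) proj_orth ?subr0 //; exact: in_span_proj.
have : B ^+ 2 <= eta * B * A.
  apply: le_trans (ler_wpM2r A0 (approx_proj Sd Sg gd)).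
  rewrite Bdd -sqrtrM ?(form_ge0 ha) //; apply: le_trans (ler_norm _) _.
  rewrite -sqrtr_sqr; apply: ler_wsqrtr.
  exact: (form_cauchy_schwarz hS ha Sd' Sd).
by rewrite expr2 mulrAC ler_pM2r.
Qed.

Lemma sum_form_sq_le x : S x -> \sum_j b x (e j) ^+ 2 <= mu1 * b x x.
Proof.
move=> Sx; set s := \sum_j _; pose y := \sum_j b x (e j) *: e j.
have Sy : S y by exact: linear_subspace_sum.
have ay : a y y = s by rewrite form_comb_sq.
have bxy : b x y = s by rewrite (form_sumr hS hb).
have s0 : 0 <= s by apply: sumr_ge0 => j _; exact: sqr_ge0.
have bx := form_ge0 hb Sx.
have : s ^+ 2 <= b x x * (mu1 * s).
  rewrite -{1}bxy -ay; apply: le_trans (form_cauchy_schwarz hS hb Sx Sy) _.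
  by apply: ler_wpM2l => //; exact: b_le_a.
have [->|s_neq0] := eqVneq s 0; first by rewrite mulr_ge0.
rewrite mulrCA mulrA expr2 ler_pM2r ?lt_def ?s_neq0 //.
Qed.

Variables (mu : 'I_N -> R) (i : 'I_N) (d mub : R) (x : V).
Hypothesis e_eigen : forall j k, b (e j) (e k) = mu j * a (e j) (e k).
Hypotheses (d_ge0 : 0 <= d) (gap : forall j, j != i -> 1 <= d * `|mu j - mub|).
Hypotheses (Sx : S x) (x_eigen : forall v, S v -> b x v = mub * a x v).

Let res := x - proj x.
Let Ex := a x (e i) *: e i.
Let c j := if j == i then 0 else a x (e j).
Let y := \sum_j c j *: e j.

Let Sres : S res. Proof. exact: linear_subspaceB (projS x). Qed.
Let Sy : S y. Proof. exact: linear_subspace_sum. Qed.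
Let span_Ex : in_span Ex. Proof. exact/in_spanZ/in_span_gen. Qed.

Let proj_Ex : proj x - Ex = y.
Proof.
rewrite /proj /y (bigD1 i) //= [RHS](bigD1 i) //= /c eqxx scale0r add0r.
rewrite /Ex [_ + _ - _]addrC addKr; apply: eq_bigr => j /negbTE ji.
by rewrite ji.
Qed.

Let res_split : x - Ex = res + y.
Proof. by rewrite -proj_Ex subrKA. Qed.

Let res_coef j : b res (e j) = (mub - mu j) * a x (e j).
Proof.
rewrite (psdBl hS hb) //; last exact: projS.
rewrite x_eigen // mulrBl; congr (_ - _).
rewrite (form_suml hS hb) // (bigD1 j) //= e_eigen orth eqxx big1.
  by rewrite /=; ring.
by move=> k /negbTE kj; rewrite e_eigen orth kj !mulr0.
Qed.

Let y_le : a y y <= d ^+ 2 * (mu1 * b res res).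
Proof.
rewrite form_comb_sq.
apply: le_trans (ler_wpM2l (sqr_ge0 d) (sum_form_sq_le Sres)).
rewrite mulr_sumr; apply: ler_sum => j _; rewrite /c.
have [_|ji] := eqVneq j i; first by rewrite expr0n mulr_ge0 ?sqr_ge0.
rewrite res_coef exprMn mulrA; apply: ler_peMl; first exact: sqr_ge0.
rewrite -exprMn -real_normK ?num_real // expr_ge1 //.
by rewrite normrM (ger0_norm d_ge0) distrC gap.
Qed.

Let res_le : b res res <= eta ^+ 2 * a res res.
Proof.
have := proj_form_le Sx; rewrite -/res => hB.
rewrite -(sqr_sqrtr (form_ge0 hb Sres)) -[a res res](sqr_sqrtr (form_ge0 ha Sres)).
rewrite -exprMn ler_sqr ?nnegrE //; last exact: mulr_ge0.
Qed.

Lemma eigen_proj_energy_le :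
  Num.sqrt (a (x - Ex) (x - Ex)) <=
  Num.sqrt (1 + eta ^+ 2 * mu1 * d ^+ 2) *
  Num.sqrt (a (x - proj x) (x - proj x)).
Proof.
rewrite -sqrtrM; last first.
  by rewrite addr_ge0 // !mulr_ge0 // exprn_ge0.
apply: ler_wsqrtr; rewrite (form_sub_span Sx span_Ex) proj_Ex mulrDl mul1r lerD2l.
apply: le_trans y_le _; rewrite -/res.
rewrite [leRHS](_ : _ = d ^+ 2 * (mu1 * (eta ^+ 2 * a res res))); last by ring.
by rewrite ler_wpM2l ?sqr_ge0 // ler_wpM2l.
Qed.

Lemma eigen_proj_form_le :
  Num.sqrt (b (x - Ex) (x - Ex)) <=
  (1 + mu1 * d) * eta * Num.sqrt (a (x - Ex) (x - Ex)).
Proof.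
rewrite {1 2}res_split; apply: le_trans (form_triangle hS hb Sres Sy) _.
have by_le : Num.sqrt (b y y) <= mu1 * d * Num.sqrt (b res res).
  have md0 : 0 <= mu1 * d by exact: mulr_ge0.
  rewrite -[X in X * _](ger0_norm md0) -sqrtr_sqr -sqrtrM ?sqr_ge0 //.
  apply: ler_wsqrtr; apply: le_trans (b_le_a Sy) _.
  apply: le_trans (ler_wpM2l mu1_ge0 y_le) _.
  by rewrite le_eqVlt; apply/orP; left; apply/eqP; ring.
apply: le_trans (lerD (lexx _) by_le) _.
rewrite -[X in X + _]mul1r -mulrDl -mulrA; apply: ler_wpM2l.
  by rewrite addr_ge0 // mulr_ge0.
apply: le_trans (proj_form_le Sx) _; apply: ler_wpM2l => //.
by apply: ler_wsqrtr; exact: proj_best.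
Qed.

End projection.

(* [x - (lamb * a x (e i) / lami) *: uhat] is the solution with right-hand side
   [lamb *: (x - Ex)], hence close to [W] up to a multiple of [uhat]. *)
Lemma augmented_subspace_step (S : set V) (a b : V -> V -> R) (N N' : nat)
    (e : 'I_N -> V) (e' : 'I_N' -> V) (mu1 eta : R) (W : set V)
    (mu : 'I_N -> R) (mu' : 'I_N' -> R) (i : 'I_N) (i' : 'I_N')
    (d d' lamb lami : R) (x uhat Ex Ex' : V) :
  linear_subspace S -> psd_form S a -> psd_form S b ->
  (forall j, S (e j)) -> (forall j, S (e' j)) ->
  (forall p q, a (e p) (e q) = (p == q)%:R) ->
  (forall p q, a (e' p) (e' q) = (p == q)%:R) ->
  0 <= mu1 -> (forall v, S v -> b v v <= mu1 * a v v) -> 0 <= eta ->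
  (forall f, S f -> exists g, S g /\ forall v, S v -> a g v = b f v) ->
  (forall f g, S f -> S g -> (forall v, S v -> a g v = b f v) -> b f f = 1 ->
    forall k, eta < k -> exists w, W w /\ Num.sqrt (a (g - w) (g - w)) < k) ->
  (forall w, W w -> in_span e w) -> (forall w, W w -> in_span e' w) ->
  (forall j k, b (e j) (e k) = mu j * a (e j) (e k)) ->
  (forall j k, b (e' j) (e' k) = mu' j * a (e' j) (e' k)) ->
  0 <= d -> (forall j, j != i -> 1 <= d * `|mu j - lamb^-1|) ->
  0 <= d' -> (forall j, j != i' -> 1 <= d' * `|mu' j - lamb^-1|) ->
  0 < lamb -> S x -> (forall v, S v -> b x v = lamb^-1 * a x v) ->
  lami != 0 -> S uhat -> in_span e' uhat ->
  (forall v, S v -> a uhat v = lami * b (e i) v) ->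
  Ex = a x (e i) *: e i -> Ex' = a x (e' i') *: e' i' ->
  Num.sqrt (a (x - Ex') (x - Ex')) <=
  lamb * Num.sqrt (1 + eta ^+ 2 * mu1 * d' ^+ 2) * (1 + mu1 * d) * eta ^+ 2 *
  Num.sqrt (a (x - Ex) (x - Ex)).
Proof.
move=> hS ha hb Se Se' orth orth' mu1_ge0 b_le eta_ge0 solv appr We We'.
move=> eig eig' d0 gap d'0 gap' lamb0 Sx xeig lami0 Suh uh_span uhE ExE Ex'E.
have SEx : S Ex by rewrite ExE; exact: linear_subspaceZ.
have Sr := linear_subspaceB hS Sx SEx.
have lamb_neq0 := lt0r_neq0 lamb0.
have hE' := eigen_proj_energy_le hS ha Se' orth' hb mu1_ge0 b_le eta_ge0 solv
  appr We' eig' d'0 gap' Sx xeig; rewrite -Ex'E in hE'.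
have hE := eigen_proj_form_le hS ha Se orth hb mu1_ge0 b_le eta_ge0 solv
  appr We eig d0 gap Sx xeig; rewrite -ExE in hE.
apply: le_trans hE' _.
pose k := lamb * a x (e i) / lami; pose z := x - k *: uhat.
have Skuh : S (k *: uhat) by exact: linear_subspaceZ.
have Sz : S z by exact: linear_subspaceB.
have Sf : S (lamb *: (x - Ex)) by exact: linear_subspaceZ.
have zE v : S v -> a z v = b (lamb *: (x - Ex)) v.
  move=> Sv; rewrite (psdBl hS ha) // !(psdZl hS ha, psdZl hS hb) //.
  rewrite (psdBl hS hb) // ExE (psdZl hS hb) // xeig // uhE // /k.
  by field; apply/andP.
have := approx_proj hS ha Se' orth' hb appr We' Sf Sz zE.
rewrite (psdZl hS hb) // (psdZr hS hb) // mulrA -expr2 sqrtrM ?sqr_ge0 //.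
rewrite sqrtr_sqr (gtr0_norm lamb0) => hz.
have hx : Num.sqrt (a (x - proj a e' x) (x - proj a e' x)) <=
    eta * (lamb * ((1 + mu1 * d) * eta * Num.sqrt (a (x - Ex) (x - Ex)))).
  apply: le_trans (le_trans _ hz) _; last first.
    by rewrite ler_wpM2l // ler_wpM2l // ltW.
  apply: ler_wsqrtr; have -> : z - proj a e' z = x - (k *: uhat + proj a e' z).
    by rewrite opprD addrA.
  apply: (proj_best hS ha Se' orth') => //.
  by apply: in_spanD; [exact: in_spanZ|exact: in_span_proj].
apply: le_trans (ler_wpM2l (sqrtr_ge0 _) hx) _.
by rewrite le_eqVlt; apply/orP; left; apply/eqP; ring.
Qed.

End forms.

(** * Bounded measurable functions and Lebesgue measure on row vectors *)

Section multivariate_polynomials.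
Variables (R : comNzRingType) (n : nat).
Implicit Types (k : R) (p q : mpoly.mpoly n R) (x : 'rV[R]_n).

Lemma peval0 x : peval 0 x = 0.
Proof. exact: mpoly.meval0. Qed.

Lemma peval_linear k p q x : peval (k *: p + q) x = k * peval p x + peval q x.
Proof. by rewrite /peval mpoly.mevalD mpoly.mevalZ. Qed.

Lemma peval_rect (P : ('rV[R]_n -> R) -> Prop) :
  (forall k, P (fun=> k)) -> (forall i, P (fun x => x 0 i)) ->
  (forall f g, P f -> P g -> P (fun x => f x + g x)) ->
  (forall f g, P f -> P g -> P (fun x => f x * g x)) ->
  (forall f g, f =1 g -> P f -> P g) ->
  forall p, P (peval p).
Proof.
move=> Pc Px PD PM Pext p.
have Ppow f d : P f -> P (fun x => f x ^+ d).
  move=> Pf; elim: d => [|d IH].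
    by apply: (Pext (fun=> 1)) => [x|]; [rewrite expr0|exact: Pc].
  by apply: (Pext (fun x => f x * f x ^+ d)) => [x|]; [rewrite exprS|exact: PM].
have Pprod (s : seq 'I_n) (m : mpoly.multinom n) :
    P (fun x => \prod_(i <- s) x 0 i ^+ m i).
  elim: s => [|i s IH].
    by apply: (Pext (fun=> 1)) => [x|]; [rewrite big_nil|exact: Pc].
  apply: (Pext (fun x => x 0 i ^+ m i * \prod_(j <- s) x 0 j ^+ m j)) => [x|].
    by rewrite big_cons.
  by apply: PM => //; exact: Ppow.
suff Psum (s : seq (mpoly.multinom n)) :
    P (fun x => \sum_(m <- s) mpoly.mcoeff m p * \prod_i x 0 i ^+ m i).
  by apply: Pext (Psum (mpoly.msupp p)) => x; rewrite /peval mpoly.mevalE.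
elim: s => [|m s IH].
  by apply: (Pext (fun=> 0)) => [x|]; [rewrite big_nil|exact: Pc].
apply: (Pext (fun x => mpoly.mcoeff m p * (\prod_i x 0 i ^+ m i) +
    \sum_(m <- s) mpoly.mcoeff m p * \prod_i x 0 i ^+ m i)) => [x|].
  by rewrite big_cons.
by apply: PD => //; apply: PM.
Qed.

Lemma deg_le0 d : deg_le d (0 : mpoly.mpoly n R).
Proof. by rewrite /deg_le mpoly.mmeasure0. Qed.

Lemma deg_le_linear d k p q : deg_le d p -> deg_le d q -> deg_le d (k *: p + q).
Proof.
rewrite /deg_le => hp hq; apply: leq_trans (mpoly.msizeD_le _ _) _.
by rewrite geq_max hq (leq_trans (mpoly.mmeasureZ_le _ _ _) hp).
Qed.

Definition pvec_linear k (q q' : pvec R n) : pvec R n := fun i => k *: q i + q' i.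

Lemma in_G_linear r t k (q q' : pvec R n) :
  in_G r t q -> in_G r t q' -> in_G r t (pvec_linear k q q').
Proof.
rewrite /in_G; case: ifP => _; last first.
  by move=> hq hq' i; exact: deg_le_linear.
move=> [p [s [hp hs hq]]] [p' [s' [hp' hs' hq']]].
exists (pvec_linear k p p'), (k *: s + s'); split.
- by move=> i; exact: deg_le_linear.
- by rewrite rpredD // rpredZ.
- move=> i; rewrite /pvec_linear hq hq' mulrDl scalerDr scalerAl.
  by rewrite addrACA.
Qed.

Lemma pvec_eval_linear k (q q' : pvec R n) x :
  pvec_eval (pvec_linear k q q') x = k *: pvec_eval q x + pvec_eval q' x.
Proof. by apply/rowP => i; rewrite !mxE peval_linear. Qed.

End multivariate_polynomials.

Section bounded_measurable.
Context d {T : measurableType d} {R : realType}.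
Implicit Types (D : set T) (f g : T -> R).

Definition bounded_measurable D f : Prop :=
  measurable_fun D f /\ exists B, forall x, D x -> `|f x| <= B.

Lemma bounded_measurable_cst D (k : R) : bounded_measurable D (fun=> k).
Proof. by split; [exact: measurable_cst|exists `|k|]. Qed.

Lemma bounded_measurableD D f g :
  bounded_measurable D f -> bounded_measurable D g ->
  bounded_measurable D (fun x => f x + g x).
Proof.
move=> [mf [B fB]] [mg [B' gB]]; split; first exact: measurable_funD.
exists (B + B') => x Dx; apply: le_trans (ler_normD _ _) _.
by apply: lerD; [exact: fB|exact: gB].
Qed.

Lemma bounded_measurableM D f g :
  bounded_measurable D f -> bounded_measurable D g ->
  bounded_measurable D (fun x => f x * g x).
Proof.
move=> [mf [B fB]] [mg [B' gB]]; split; first exact: measurable_funM.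
exists (B * B') => x Dx; rewrite normrM.
by apply: ler_pM => //; [exact: fB|exact: gB].
Qed.

Lemma eq_bounded_measurable D f g : (forall x, D x -> f x = g x) ->
  bounded_measurable D f -> bounded_measurable D g.
Proof.
move=> fg [mf [B fB]]; split.
  by apply: eq_measurable_fun mf => x /set_mem; exact: fg.
by exists B => x Dx; rewrite -fg //; exact: fB.
Qed.

Lemma bounded_measurable_sum D (I : Type) (s : seq I) (F : I -> T -> R) :
  (forall i, bounded_measurable D (F i)) ->
  bounded_measurable D (fun x => \sum_(i <- s) F i x).
Proof.
move=> mF; elim: s => [|i s IH].
  under eq_fun do rewrite big_nil.
  exact: bounded_measurable_cst.
under eq_fun do rewrite big_cons.
exact: bounded_measurableD.
Qed.

Variables (mu : {measure set T -> \bar R}) (D : set T).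
Hypotheses (mD : measurable D) (finD : (mu D < +oo)%E).

Lemma bounded_measurable_integrable f :
  bounded_measurable D f -> mu.-integrable D (EFin \o f).
Proof.
move=> [mf [B fB]]; apply: measurable_bounded_integrable => //.
exists B; split; first exact: num_real.
by move=> M BM x Dx; apply: le_trans (ltW BM); exact: fB.
Qed.

Lemma Rintegral_linear k f g :
  bounded_measurable D f -> bounded_measurable D g ->
  \int[mu]_(x in D) (k * f x + g x) =
  k * \int[mu]_(x in D) f x + \int[mu]_(x in D) g x.
Proof.
move=> bf bg; rewrite RintegralD //.
- by rewrite RintegralZl //; exact: bounded_measurable_integrable.
- apply: bounded_measurable_integrable; apply: bounded_measurableM => //.
  exact: bounded_measurable_cst.
- exact: bounded_measurable_integrable.
Qed.

End bounded_measurable.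

Section euclidean_measure.
Variable R : realType.

Definition box n (B : R) : set 'rV[R]_n := [set x | forall i, `|x 0 i| <= B].

Lemma measurable_box n B : measurable (@box n B).
Proof.
have -> : @box n B = \bigcap_(i in [set: 'I_n]) [set x | `|x 0 i| <= B].
  by apply/seteqP; split => [x Hx i _|x Hx i]; exact: Hx.
apply: fin_bigcap_measurable => // i _.
rewrite -[X in measurable X]setTI
  (_ : [set x | _] = (fun x => x 0 i) @^-1` `[-B, B]%classic).
  by apply: measurable_coord => //; exact: measurable_itv.
by apply/seteqP; split => x /=; rewrite in_itv /= ler_norml.
Qed.

Lemma lebesgue_rv_box n B : (lebesgue_rv R n (@box n B) < +oo)%E.
Proof.
elim: n => [|n IH] /=.
  by rewrite /= diracE ltry.
rewrite /lebesgue_step /pushforward.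
have -> : @rv_cons R n @^-1` @box n.+1 B = `[-B, B]%classic `*` @box n B.
  apply/seteqP; split => [[t v] /= Hx|[t v] /= [Ht Hv] i].
    split; first by have := Hx ord0; rewrite mxE unlift_none /= in_itv /= ler_norml.
    by move=> i; have := Hx (lift ord0 i); rewrite mxE liftK.
  rewrite mxE; case: unliftP => [j|] _ /=; first exact: Hv.
  by move: Ht; rewrite in_itv /= ler_norml.
rewrite product_measure1E //; last exact: measurable_box.
by rewrite lte_mul_pinfty //= lebesgue_measure_itv /=; case: ifP => _; rewrite ?ltry.
Qed.

Lemma measurable_fun_sum d (T : measurableType d) (D : set T) (I : Type)
    (s : seq I) (F : I -> T -> R) :
  (forall i, measurable_fun D (F i)) ->
  measurable_fun D (fun x => \sum_(i <- s) F i x).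
Proof.
move=> mF; elim: s => [|i s IH].
  under eq_fun do rewrite big_nil.
  exact: measurable_cst.
under eq_fun do rewrite big_cons.
exact: measurable_funD.
Qed.

Lemma measurable_affine m n (M : 'M[R]_(m, n)) (w : 'rV[R]_n) :
  measurable_fun [set: 'rV[R]_m] (fun x => w + x *m M).
Proof.
apply: measurable_to_rv => i.
under eq_fun do rewrite !mxE.
apply: measurable_funD; first exact: measurable_cst.
apply: measurable_fun_sum => j; apply: measurable_funM; last exact: measurable_cst.
exact: measurable_coord.
Qed.

Lemma measurable_dot n (w : 'rV[R]_n) : measurable_fun [set: 'rV[R]_n] (dot w).
Proof.
apply: measurable_fun_sum => j; apply: measurable_funM; first exact: measurable_cst.
exact: measurable_coord.
Qed.

Lemma measurable_halfspace n (w : 'rV[R]_n) (k : R) :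
  measurable [set x | dot w x < k].
Proof.
rewrite -[X in measurable X]setTI (_ : [set x | _] = dot w @^-1` `]-oo, k[%classic).
  by apply: measurable_dot => //; exact: measurable_itv.
by apply/seteqP; split => x /=; rewrite in_itv.
Qed.

Lemma measurable_polyhedron n m (N : 'I_m -> 'rV[R]_n) (c : 'I_m -> R) :
  measurable [set x | forall k, dot (N k) x < c k].
Proof.
rewrite (_ : [set x | _] =
    \bigcap_(k in [set: 'I_m]) [set x | dot (N k) x < c k]).
  by apply: fin_bigcap_measurable => // k _; exact: measurable_halfspace.
by apply/seteqP; split => [x Hx i _|x Hx i]; exact: Hx.
Qed.

Lemma measurable_std_simplex n : measurable (@std_simplex R n).
Proof.
rewrite (_ : @std_simplex R n = [set x | forall i, dot (- delta_mx 0 i) x < 0] `&`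
    [set x | dot (const_mx 1) x < 1]).
  by apply: measurableI; [exact: measurable_polyhedron|exact: measurable_halfspace].
have dotN i (x : 'rV[R]_n) : dot (- delta_mx 0 i) x = - x 0 i.
  rewrite /dot (bigD1 i) //= big1 ?addr0 ?mxE ?eqxx ?mulN1r // => j ji.
  by rewrite !mxE (negbTE ji) andbF oppr0 mul0r.
have dot1 (x : 'rV[R]_n) : dot (const_mx 1) x = \sum_i x 0 i.
  by apply: eq_bigr => i _; rewrite mxE mul1r.
apply/seteqP; split=> x [] /= h1; rewrite ?dot1 => h2; split => //= i.
  by rewrite dotN oppr_lt0.
by have := h1 i; rewrite dotN oppr_lt0.
Qed.

Lemma std_simplex_box n : @std_simplex R n `<=` box 1.
Proof.
move=> x [x0 x1] i; rewrite gtr0_norm //; apply: le_trans (ltW x1).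
rewrite (bigD1 i) //= lerDl; apply: sumr_ge0 => j _; exact: ltW.
Qed.

Lemma bounded_measure_lty n (D : set 'rV[R]_n) B :
  measurable D -> D `<=` box B -> (lebesgue_rv R n D < +oo)%E.
Proof.
move=> mD DB; apply: le_lt_trans (lebesgue_rv_box n B).
by apply: le_measure => //; rewrite inE //; exact: measurable_box.
Qed.

Lemma bounded_measurable_coord n (D : set 'rV[R]_n) B i :
  measurable D -> D `<=` box B -> bounded_measurable D (fun x => x 0 i).
Proof.
move=> mD DB; split; last by exists B => x /DB.
exact: measurable_funS (measurable_coord i).
Qed.

Lemma bounded_measurable_peval d (T : measurableType d) n (D : set T)
    (f : T -> 'rV[R]_n) p :
  (forall i, bounded_measurable D (fun x => f x 0 i)) ->
  bounded_measurable D (fun x => peval p (f x)).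
Proof.
move=> bf; move: p.
apply: (@peval_rect R n (fun g => bounded_measurable D (fun x => g (f x))))
  => [k|i|g h|g h|g h gh].
- exact: bounded_measurable_cst.
- exact: bf.
- exact: bounded_measurableD.
- exact: bounded_measurableM.
- by apply: eq_bounded_measurable => x _.
Qed.

End euclidean_measure.

(** * Simplices *)

Section simplices.
Variable R : realType.

Lemma osimplexP k n (P : 'I_k.+1 -> 'rV[R]_n) x :
  osimplex P x <-> exists2 y, std_simplex y & x = P ord0 + y *m edge_mx P.
Proof.
have rowE (y : 'rV[R]_k) : y *m edge_mx P =
    \sum_j y 0 j *: P (lift ord0 j) - (\sum_j y 0 j) *: P ord0.
  rewrite mulmx_sum_row scaler_suml -sumrB; apply: eq_bigr => j _.
  by rewrite rowK scalerBr.
split=> [[t [t0 t1 ->]]|[y [y0 y1] ->]].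
  move: (t1); rewrite big_ord_recl => /(canRL (addrK _)) t0E.
  exists (\row_j t (lift ord0 j)); first split => [i|].
  - by rewrite mxE.
  - under eq_bigr do rewrite mxE.
    by rewrite -subr_gt0 -t0E.
  rewrite rowE big_ord_recl t0E; under [in RHS]eq_bigr do rewrite mxE.
  under [X in _ = _ + (_ - X *: _)]eq_bigr do rewrite mxE.
  by rewrite scalerBl scale1r addrAC addrA.
exists (fun i => oapp (y 0) (1 - \sum_j y 0 j) (unlift ord0 i)); split.
- by move=> i; case: unliftP => [j|] _ //=; rewrite subr_gt0.
- rewrite big_ord_recl unlift_none /=.
  rewrite -[RHS](subrK (\sum_j y 0 j)); congr (_ + _).
  by apply: eq_bigr => j _; rewrite liftK.
rewrite rowE [in RHS]big_ord_recl unlift_none /=.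
rewrite scalerBl scale1r addrA addrAC; congr (_ + _).
by apply: eq_bigr => j _; rewrite liftK.
Qed.

Lemma osimplex_box k n (P : 'I_k -> 'rV[R]_n) : exists B, osimplex P `<=` box B.
Proof.
exists (\sum_i \sum_j `|P i 0 j|) => x [t [t0 t1 ->]] j.
rewrite summxE; apply: le_trans (ler_norm_sum _ _ _) _; apply: ler_sum => i _.
rewrite mxE normrM (gtr0_norm (t0 i)) (bigD1 j) //=.
apply: ler_wpDr; first exact: sumr_ge0.
apply: ler_piMl => //; rewrite -t1 (bigD1 i) //= lerDl.
by apply: sumr_ge0 => l _; exact: ltW.
Qed.

Lemma osimplex_sub_csimplex k n (P : 'I_k -> 'rV[R]_n) :
  osimplex P `<=` csimplex P.
Proof. by move=> x [t [t0 t1 ->]]; exists t; split => // i; exact: ltW. Qed.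

Lemma std_simplex_shift n (y w : 'rV[R]_n) : std_simplex y ->
  exists2 eps, 0 < eps & std_simplex (y + eps *: w).
Proof.
move=> [y0 y1]; pose m := \big[Num.min/1 - \sum_i y 0 i]_i y 0 i.
have m0 : 0 < m by apply/bigmin_gtP; split => [|i _] //; rewrite subr_gt0.
pose D := 1 + \sum_i `|w 0 i|.
have S0 : 0 <= \sum_i `|w 0 i| by exact: sumr_ge0.
have D0 : 0 < D by rewrite ltr_wpDr.
have small s : s <= \sum_i `|w 0 i| -> m / D * s < m.
  move=> sD; rewrite -mulrA -[ltRHS]mulr1 ltr_pM2l // mulrC ltr_pdivrMr //.
  by rewrite mul1r; apply: le_lt_trans sD _; rewrite ltrDr.
exists (m / D); [exact: divr_gt0|split=> [i|]].
  rewrite !mxE -[X in _ + X]opprK subr_gt0.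
  apply: (@lt_le_trans _ _ m); last exact: bigmin_le_cond.
  rewrite -mulrN; apply: small; apply: le_trans (ler_norm _) _.
  by rewrite normrN (bigD1 i) //= lerDl; apply: sumr_ge0.
under eq_bigr do rewrite !mxE.
rewrite big_split /= -mulr_sumr -ltrBrDl.
apply: (@lt_le_trans _ _ m); last exact: bigmin_le_id.
by apply: small; apply: ler_sum => i _; exact: ler_norm.
Qed.

Section full_dimensional.
Variables (n : nat) (P : 'I_n.+1 -> 'rV[R]_n).
Hypothesis freeP : row_free (edge_mx P).

Let E_unit : edge_mx P \in unitmx. Proof. by rewrite -row_free_unit. Qed.

Lemma osimplexE : osimplex P =
  [set x | std_simplex (- P ord0 *m invmx (edge_mx P) + x *m invmx (edge_mx P))].
Proof.
apply/seteqP; split=> x /=.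
  move=> /osimplexP[y ystd ->].
  by rewrite -mulmxDl addKr mulmxK.
move=> hstd; apply/osimplexP.
exists (- P ord0 *m invmx (edge_mx P) + x *m invmx (edge_mx P)) => //.
by rewrite -mulmxDl mulmxKV // addNKr.
Qed.

Lemma measurable_osimplex : measurable (osimplex P).
Proof.
rewrite osimplexE -[X in measurable X]setTI.
by apply: measurable_affine => //; exact: measurable_std_simplex.
Qed.

Lemma lebesgue_osimplex : (lebesgue_rv R n (osimplex P) < +oo)%E.
Proof.
have [B PB] := osimplex_box P.
by apply: bounded_measure_lty PB; exact: measurable_osimplex.
Qed.

Lemma osimplex_shift x w : osimplex P x ->
  exists2 eps, 0 < eps & osimplex P (x + eps *: w).
Proof.
rewrite osimplexE /= => /(std_simplex_shift (w *m invmx (edge_mx P)))[eps eps0].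
by move=> hstd; exists eps => //; rewrite mulmxDl -scalemxAl addrA.
Qed.

Lemma bounded_measurable_osimplex_peval p :
  bounded_measurable (osimplex P) (peval p).
Proof.
have [B PB] := osimplex_box P.
apply: (@bounded_measurable_peval R _ _ _ _ id) => i.
exact: bounded_measurable_coord measurable_osimplex PB.
Qed.

End full_dimensional.

Lemma closure_halfspace n (w : 'rV[R]_n.+1) (k : R) (D : set 'rV[R]_n.+1) :
  (forall x, D x -> dot w x < k) -> forall x, closure D x -> dot w x <= k.
Proof.
move=> Dk x Dx.
have dot_cont : continuous (dot w).
  rewrite /dot; move: (index_enum _) => s; elim: s => [|i s IH].
    rewrite (_ : (fun y => _) = fun=> 0); first exact: cst_continuous.
    by apply/funext => y; rewrite big_nil.
  rewrite (_ : (fun y => _) = (fun y : 'rV[R]_n.+1 =>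
      w 0 i * y 0 i + \sum_(j <- s) w 0 j * y 0 j)); last first.
    by apply/funext => y; rewrite big_cons.
  move=> y; apply: cvgD; [exact: (@nbhs_filter _ y)| |exact: IH].
  apply: cvgM; [exact: (@nbhs_filter _ y)| |].
    exact: (@cvg_cst _ _ _ _ (@nbhs_filter _ y)).
  exact: coord_continuous.
have hcl : closed [set y | dot w y <= k].
  exact: (preimage_closed (fun y _ => dot_cont y) (@closed_le R k)).
apply: (hcl x) => B Bx; have [z [Dz Bz]] := Dx B Bx.
by exists z; split => //; exact/ltW/Dk.
Qed.

Lemma osimplex_sub_domain n m (Omega : set 'rV[R]_n.+1) (T : mesh R n m) k :
  convex_polyhedral_domain Omega -> triangulation Omega T ->
  osimplex (T k) `<=` Omega.
Proof.
move=> [[x0 Ox0] _ [l [N [c OmegaE]]]] [free clE _ _] x Tx.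
have clT y : osimplex (T k) y -> closure Omega y.
  by move=> /osimplex_sub_csimplex Ty; rewrite clE; exists k.
have le_c j y : osimplex (T k) y -> dot (N j) y <= c j.
  move=> /clT; apply: closure_halfspace => z; rewrite OmegaE; exact.
have dotD (w y z : 'rV[R]_n.+1) (t : R) :
    dot w (y + t *: z) = dot w y + t * dot w z.
  rewrite /dot mulr_sumr -big_split /=; apply: eq_bigr => i _.
  by rewrite !mxE; ring.
rewrite OmegaE => j /=.
have [eps eps0 Tw] := osimplex_shift (free k) (N j) Tx.
have := le_c j _ Tw; rewrite dotD.
have [N0|N0] := eqVneq (dot (N j) (N j)) 0; last first.
  have : 0 < dot (N j) (N j).
    by rewrite lt_def N0 /=; apply: sumr_ge0 => i _; rewrite -expr2 sqr_ge0.
  by move=> Npos; apply: lt_le_trans; rewrite ltrDl mulr_gt0.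
move=> _; have Nj0 i : N j 0 i = 0.
  have /psumr_eq0P : forall i, true -> 0 <= N j 0 i * N j 0 i.
    by move=> i' _; rewrite -expr2 sqr_ge0.
  by move=> /(_ N0 i isT) /eqP; rewrite mulf_eq0 orbb => /eqP.
have dot0 y : dot (N j) y = 0 by rewrite /dot big1 // => i _; rewrite Nj0 mul0r.
by move: Ox0; rewrite OmegaE => /(_ j); rewrite !dot0.
Qed.

End simplices.

(** * Weak Galerkin forms *)

Section bounded_measurable_ae.
Context d {T : measurableType d} {R : realType}.
Variables (mu : {measure set T -> \bar R}) (D : set T).
Hypotheses (mD : measurable D) (finD : (mu D < +oo)%E).
Implicit Types f g : T -> R.

Lemma ae_eq_Rintegral f g : measurable_fun D f -> measurable_fun D g ->
  {ae mu, forall x, D x -> f x = g x} ->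
  \int[mu]_(x in D) f x = \int[mu]_(x in D) g x.
Proof.
move=> mf mg fg; congr fine; apply: ae_eq_integral => //.
- exact/measurable_EFinP.
- exact/measurable_EFinP.
- by apply: filterS fg => x + Dx => /(_ Dx) ->.
Qed.

Lemma ge0_Rintegral_eq0 f : bounded_measurable D f ->
  (forall x, D x -> 0 <= f x) -> \int[mu]_(x in D) f x = 0 ->
  {ae mu, forall x, D x -> f x = 0}.
Proof.
move=> bf f0 int0; have mf : measurable_fun D (EFin \o f).
  by apply/measurable_EFinP; case: bf.
have /(ae_eq_integral_abs _ mD mf) : (\int[mu]_(x in D) `|(EFin \o f) x| = 0)%E.
  under eq_integral => x /set_mem Dx do rewrite /= ger0_norm ?f0 //.
  rewrite -[LHS]fineK; first by rewrite (_ : fine _ = 0).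
  exact: integrable_fin_num (bounded_measurable_integrable mD finD bf).
by apply: filterS => x + Dx => /(_ Dx) [].
Qed.

End bounded_measurable_ae.

Section poly_on_theory.
Variables (R : realType) (n : nat).

Lemma poly_on0 k (S : set 'rV[R]_n.+1) : poly_on k S (fun=> 0).
Proof. by exists 0; split=> [|x _]; [exact: deg_le0|rewrite peval0]. Qed.

Lemma poly_on_linear k (S : set 'rV[R]_n.+1) (a : R) (f g : 'rV[R]_n.+1 -> R) :
  poly_on k S f -> poly_on k S g -> poly_on k S (fun x => a * f x + g x).
Proof.
move=> [p [dp fp]] [q [dq gq]]; exists (a *: p + q).
split=> [|x Sx]; first exact: deg_le_linear.
by rewrite peval_linear fp // gq.
Qed.

Lemma WG_subspace m (Omega : set 'rV[R]_n.+1) (T : mesh R n m) r t :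
  linear_subspace (WG_space Omega T r t).
Proof.
split.
  by rewrite /WG_space /=; split=> // k *; exact: poly_on0.
move=> a u v; rewrite /WG_space /= => -[u1 u2 u3 u4 u5] [v1 v2 v3 v4 v5]; split.
- by move=> k; exact: poly_on_linear.
- move=> x Tx; change (a * u.1 x + v.1 x = 0).
  by rewrite u2 // v2 // mulr0 addr0.
- by move=> k i; exact: poly_on_linear.
- move=> k i kb x Tx; change (a * u.2 x + v.2 x = 0).
  by rewrite (u4 k i) // (v4 k i) // mulr0 addr0.
- move=> x Tx; change (a * u.2 x + v.2 x = 0).
  by rewrite u5 // v5 // mulr0 addr0.
Qed.

End poly_on_theory.

Section weak_galerkin_forms.
Variables (R : realType) (n m : nat) (Omega : set 'rV[R]_n.+1) (T : mesh R n m).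
Variables (r t : nat).
Hypothesis freeT : forall k, row_free (edge_mx (T k)).
Local Notation leb := (lebesgue_rv R n.+1).
Local Notation Vh := (WG_space Omega T r t).
Local Notation wf := (wfun R n).

Let mcell k := measurable_osimplex (freeT k).
Let fcell k := lebesgue_osimplex (freeT k).



Lemma poly_on_bounded_measurable d f k :
  poly_on d (osimplex (T k)) f -> bounded_measurable (osimplex (T k)) f.
Proof.
move=> [p [_ fp]]; apply: (@eq_bounded_measurable _ _ _ _ (peval p)).
  by move=> x /fp.
exact: bounded_measurable_osimplex_peval.
Qed.

Lemma WG_bounded_measurable v k : Vh v -> bounded_measurable (osimplex (T k)) v.1.
Proof.
by rewrite /WG_space => -[/(_ k) + _ _ _ _]; exact: poly_on_bounded_measurable.
Qed.

Lemma b_h_form : psd_form Vh (b_h T).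
Proof.
split.
- move=> a u v w Vu Vv Vw; rewrite /b_h mulr_sumr -big_split.
  apply: eq_bigr => k _ /=.
  rewrite -(Rintegral_linear (mcell k) (fcell k)).
  + by apply: eq_Rintegral => x _; rewrite /= mulrDl mulrA.
  + by apply: bounded_measurableM; exact: WG_bounded_measurable.
  + by apply: bounded_measurableM; exact: WG_bounded_measurable.
- move=> u v _ _; apply: eq_bigr => k _; apply: eq_Rintegral => x _.
  exact: mulrC.
- move=> u _; apply: sumr_ge0 => k _; apply: Rintegral_ge0 => x _.
  by rewrite -expr2 sqr_ge0.
Qed.

Lemma dot_linear a (x y z : 'rV[R]_n.+1) :
  dot (a *: x + y) z = a * dot x z + dot y z.
Proof.
rewrite /dot mulr_sumr -big_split; apply: eq_bigr => i _ /=.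
by rewrite !mxE mulrDl mulrA.
Qed.

Lemma bounded_measurable_dot d (U : measurableType d) (D : set U)
    (f g : U -> 'rV[R]_n.+1) :
  (forall i, bounded_measurable D (fun x => f x 0 i)) ->
  (forall i, bounded_measurable D (fun x => g x 0 i)) ->
  bounded_measurable D (fun x => dot (f x) (g x)).
Proof.
by move=> bf bg; apply: bounded_measurable_sum => i; exact: bounded_measurableM.
Qed.

Lemma bounded_measurable_pvec_eval (q : pvec R n.+1) k i :
  bounded_measurable (osimplex (T k)) (fun x => pvec_eval q x 0 i).
Proof.
under eq_fun do rewrite mxE.
exact: bounded_measurable_osimplex_peval.
Qed.

Lemma face_integrand_bounded_measurable v k i (q : pvec R n.+1) : Vh v ->
  bounded_measurable (@std_simplex R n) (fun y =>
    v.2 (face (T k) i ord0 + y *m edge_mx (face (T k) i)) *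
    dot (pvec_eval q (face (T k) i ord0 + y *m edge_mx (face (T k) i)))
      (outward_unit_normal (T k) i)).
Proof.
rewrite /WG_space => -[_ _ /(_ k i)[p [_ vp]] _ _]; set P := face (T k) i in vp *.
have bp p' : bounded_measurable (@std_simplex R n)
    (fun y => peval p' (P ord0 + y *m edge_mx P)).
  apply: bounded_measurable_peval => j.
  under eq_fun do rewrite !mxE.
  apply: bounded_measurableD; first exact: bounded_measurable_cst.
  apply: bounded_measurable_sum => l; apply: bounded_measurableM.
    apply: bounded_measurable_coord (@std_simplex_box R n).
    exact: measurable_std_simplex.
  exact: bounded_measurable_cst.
apply: bounded_measurableM.
  apply: eq_bounded_measurable (bp p) => y ystd; rewrite vp //.
  by apply/osimplexP; exists y.
apply: bounded_measurable_dot => j; last exact: bounded_measurable_cst.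
under eq_fun do rewrite mxE.
exact: bp.
Qed.

Lemma lebesgue_std_simplex : (lebesgue_rv R n (@std_simplex R n) < +oo)%E.
Proof.
exact: bounded_measure_lty (@measurable_std_simplex R n) (@std_simplex_box R n).
Qed.

Definition weak_gradient_rhs (v : wf) k (q : pvec R n.+1) : R :=
  (- (\int[leb]_(x in osimplex (T k)) (v.1 x * peval (pvec_div q) x))) +
  \sum_i simplex_integral (face (T k) i) (fun x =>
    v.2 x * dot (pvec_eval q x) (outward_unit_normal (T k) i)).

Lemma weak_gradient_rhs_linear a u v k q : Vh u -> Vh v ->
  weak_gradient_rhs (a *: u + v) k q =
  a * weak_gradient_rhs u k q + weak_gradient_rhs v k q.
Proof.
move=> Vu Vv; rewrite /weak_gradient_rhs mulrDr addrACA; congr (_ + _).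
  rewrite mulrN -opprD; congr (- _).
  rewrite -(Rintegral_linear (mcell k) (fcell k)).
  + by apply: eq_Rintegral => x _; rewrite /= mulrDl mulrA.
  + apply: bounded_measurableM; first exact: WG_bounded_measurable.
    exact: bounded_measurable_osimplex_peval.
  + apply: bounded_measurableM; first exact: WG_bounded_measurable.
    exact: bounded_measurable_osimplex_peval.
rewrite mulr_sumr -big_split; apply: eq_bigr => i _ /=.
rewrite /simplex_integral mulrCA -mulrDr; congr (_ * _).
rewrite -(Rintegral_linear (@measurable_std_simplex R n) lebesgue_std_simplex).
- by apply: eq_Rintegral => x _; rewrite /= mulrDl mulrA.
- exact: face_integrand_bounded_measurable.
- exact: face_integrand_bounded_measurable.
Qed.

Variable gradw : wf -> 'rV[R]_n.+1 -> 'rV[R]_n.+1.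
Hypothesis hgradw : forall v, Vh v -> weak_gradient T r t v (gradw v).

Lemma gradw_bounded_measurable v k i : Vh v ->
  bounded_measurable (osimplex (T k)) (fun x => gradw v x 0 i).
Proof.
move=> /hgradw/(_ k)[[q [_ gq]] _].
apply: eq_bounded_measurable (bounded_measurable_pvec_eval q k i) => x Tx.
by rewrite gq.
Qed.

(* The difference of the two sides is a polynomial field of [G_r(K)] whose weak
   definition can be tested against itself. *)
Lemma gradw_linear a u v k : Vh u -> Vh v ->
  {ae leb, forall x, osimplex (T k) x ->
    gradw (a *: u + v) x = a *: gradw u x + gradw v x}.
Proof.
move=> Vu Vv; have Vw : Vh (a *: u + v) by apply: (WG_subspace _ _ _ _).2.
have [[qu [Gu gu]] Iu] := hgradw Vu k.
have [[qv [Gv gv]] Iv] := hgradw Vv k.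
have [[qw [Gw gw]] Iw] := hgradw Vw k.
set w := a *: u + v in Vw gw Iw *.
pose q := pvec_linear (-1) qw (pvec_linear a qu qv).
have Gq : in_G r t q by do 2 apply: in_G_linear => //.
have bq := bounded_measurable_pvec_eval q k.
have qE x : osimplex (T k) x ->
    pvec_eval q x = - gradw w x + (a *: gradw u x + gradw v x).
  by move=> Tx; rewrite !pvec_eval_linear gu // gv // gw // scaleN1r.
have bgrad z : Vh z -> bounded_measurable (osimplex (T k))
    (fun x => dot (gradw z x) (pvec_eval q x)).
  move=> Vz; apply: bounded_measurable_dot => // i.
  exact: gradw_bounded_measurable.
have int0 : \int[leb]_(x in osimplex (T k)) dot (pvec_eval q x) (pvec_eval q x) = 0.
  transitivity (\int[leb]_(x in osimplex (T k))
      ((-1) * dot (gradw w x) (pvec_eval q x) +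
       (a * dot (gradw u x) (pvec_eval q x) + dot (gradw v x) (pvec_eval q x)))).
    apply: eq_Rintegral => x /set_mem Tx.
    by rewrite -!dot_linear scaleN1r -qE.
  rewrite (Rintegral_linear (mcell k) (fcell k)); [|exact: bgrad|].
    rewrite (Rintegral_linear (mcell k) (fcell k)); [|exact: bgrad..].
    rewrite Iw // Iu // Iv // -!/(weak_gradient_rhs _ _ _).
    by rewrite weak_gradient_rhs_linear //; ring.
  apply: bounded_measurableD; last exact: bgrad.
  by apply: bounded_measurableM; [exact: bounded_measurable_cst|exact: bgrad].
have dot_ge0 (y : 'rV[R]_n.+1) : 0 <= dot y y.
  by apply: sumr_ge0 => i _; rewrite -expr2 sqr_ge0.
have := ge0_Rintegral_eq0 (mcell k) (fcell k)
  (bounded_measurable_dot bq bq) (fun x _ => dot_ge0 _) int0.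
apply: filterS => x + Tx => /(_ Tx) q0.
suff : pvec_eval q x = 0.
  by rewrite qE // => /eqP; rewrite addrC subr_eq0 => /eqP.
apply/rowP => i; rewrite [RHS]mxE; apply/eqP.
have /psumr_eq0P : forall i, true -> 0 <= pvec_eval q x 0 i * pvec_eval q x 0 i.
  by move=> j _; rewrite -expr2 sqr_ge0.
by move=> /(_ q0 i isT) /eqP; rewrite mulf_eq0 orbb.
Qed.

Variables (A : 'rV[R]_n.+1 -> 'M[R]_n.+1) (c C : R).
Hypotheses (hA : coefficient Omega A c C).
Hypothesis subT : forall k, osimplex (T k) `<=` Omega.

(* Polarization of the ellipticity bounds at [e_i + e_j] and [e_i - e_j]. *)
Lemma coefficient_bounded x i j : Omega x -> `|A x i j| <= 2 * C.
Proof.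
case: hA => _ _ symA [c0 C0] ell Ox.
have quadE (xi : 'cV[R]_n.+1) :
    (xi^T *m A x *m xi) 0 0 = \sum_k \sum_l xi k 0 * A x k l * xi l 0.
  rewrite mxE exchange_big; apply: eq_bigr => l _ /=.
  by rewrite mxE big_distrl; apply: eq_bigr => k _ /=; rewrite mxE.
pose d i : 'cV[R]_n.+1 := delta_mx i 0.
pose B (xi ze : 'cV[R]_n.+1) := (xi^T *m A x *m ze) 0 0.
have Bd k l : B (d k) (d l) = A x k l.
  rewrite /B /d trmx_delta -rowE mxE (bigD1 l) //= big1 => [|p pl].
    by rewrite !mxE !eqxx mulr1 addr0.
  by rewrite !mxE (negbTE pl) mulr0.
have BD (xi ze : 'cV[R]_n.+1) s : B (xi + s *: ze) (xi + s *: ze) =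
    B xi xi + s * B xi ze + s * B ze xi + s ^+ 2 * B ze ze.
  rewrite /B [(_ + _)^T]linearD /= [(_ *: _)^T]linearZ /= !mulmxDl !mulmxDr.
  by rewrite -!scalemxAl -!scalemxAr !mxE; ring.
pose I (xi ze : 'cV[R]_n.+1) := (xi^T *m ze) 0 0.
have Id k l : I (d k) (d l) = (k == l)%:R.
  by rewrite /I /d trmx_delta -rowE !mxE eqxx andbT.
have ID (xi ze : 'cV[R]_n.+1) s : I (xi + s *: ze) (xi + s *: ze) =
    I xi xi + s * I xi ze + s * I ze xi + s ^+ 2 * I ze ze.
  rewrite /I [(_ + _)^T]linearD /= [(_ *: _)^T]linearZ /= !mulmxDl !mulmxDr.
  by rewrite -!scalemxAl -!scalemxAr !mxE; ring.
have Bnn k : 0 <= A x k k.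
  have [+ _] := ell x (d k) Ox; rewrite -/(B _ _) -/(I _ _) Bd Id eqxx mulr1.
  by apply: le_trans; exact: ltW.
have bound s : s ^+ 2 = 1 ->
    A x i i + s * A x i j + s * A x j i + A x j j <= C * (2 + 2 * s * (i == j)%:R).
  move=> s2; have [_] := ell x (d i + s *: d j) Ox.
  rewrite -/(B _ _) -/(I _ _) BD ID !Bd !Id !eqxx s2 !mul1r (eq_sym j i).
  move=> /le_trans; apply; rewrite le_eqVlt; apply/orP; left; apply/eqP.
  by rewrite /=; ring.
have symij : A x j i = A x i j by rewrite -{1}(symA x Ox) mxE.
have /andP[e0 e1] : 0 <= ((i == j)%:R : R) <= 1.
  by case: (i == j); rewrite ?ler01 ?lexx.
have Bi := Bnn i; have Bj := Bnn j.
have b1 := bound 1 (expr1n _ _).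
have bN1 := bound (-1) (etrans (sqrrN 1) (expr1n _ 2)).
rewrite symij in b1 bN1.
have C1 : C * (i == j)%:R <= C by rewrite ler_piMr // ltW.
have C2 : 0 <= C * (i == j)%:R by rewrite mulr_ge0 // ltW.
by rewrite ler_norml; apply/andP; split; lra.
Qed.

Hypothesis mOmega : measurable Omega.

Lemma energy_density_bounded_measurable u v k : Vh u -> Vh v ->
  bounded_measurable (osimplex (T k))
    (fun x => (gradw v x *m (A x *m (gradw u x)^T)) 0 0).
Proof.
move=> Vu Vv; under eq_fun do rewrite mxE.
apply: bounded_measurable_sum => i; apply: bounded_measurableM.
  exact: gradw_bounded_measurable.
under eq_fun do rewrite mxE.
apply: bounded_measurable_sum => j; apply: bounded_measurableM; last first.
  by under eq_fun do rewrite mxE; exact: gradw_bounded_measurable.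
split; last by exists (2 * C) => x /subT; exact: coefficient_bounded.
by case: hA => mA _ _ _ _; exact: measurable_funS (mA i j).
Qed.

Lemma a_h_form : psd_form Vh (a_h T A gradw).
Proof.
case: (hA) => _ _ symA [c0 _] ell; split.
- move=> a u v w Vu Vv Vw; rewrite /a_h mulr_sumr -big_split.
  apply: eq_bigr => k _ /=.
  have bu := energy_density_bounded_measurable k Vu Vw.
  have bv := energy_density_bounded_measurable k Vv Vw.
  have Vz : Vh (a *: u + v) by apply: (WG_subspace _ _ _ _).2.
  have bz := energy_density_bounded_measurable k Vz Vw.
  rewrite -(Rintegral_linear (mcell k) (fcell k)) //.
  apply: ae_eq_Rintegral => //; first by case: bz.
    by apply: measurable_funD; [apply: measurable_funM|case: bv] => //; case: bu.
  apply: filterS (gradw_linear a k Vu Vv) => x + Tx => /(_ Tx) ->.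
  rewrite [(_ + _)^T]linearD /= [(_ *: _)^T]linearZ /= !mulmxDr -!scalemxAr.
  by rewrite !mxE.
- move=> u v _ _; apply: eq_bigr => k _; apply: eq_Rintegral => x /set_mem Tx.
  transitivity ((gradw v x *m (A x *m (gradw u x)^T))^T 0 0).
    by rewrite [RHS]mxE.
  by rewrite !trmx_mul trmxK symA ?mulmxA //; exact: subT Tx.
- move=> u _; apply: sumr_ge0 => k _; apply: Rintegral_ge0 => x /subT Ox.
  have [+ _] := ell x (gradw u x)^T Ox; rewrite trmxK mulmxA.
  apply: le_trans; apply: mulr_ge0; first exact: ltW.
  by rewrite mxE; apply: sumr_ge0 => i _; rewrite mxE -expr2 sqr_ge0.
Qed.

Hypothesis bOmega : exists B, Omega `<=` box B.
Hypothesis disjT : forall k l, k != l -> osimplex (T k) `&` osimplex (T l) = set0.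

Let fOmega : (leb Omega < +oo)%E.
Proof. by case: bOmega => B; exact: bounded_measure_lty. Qed.

Lemma restrict_cells (f : 'rV[R]_n.+1 -> R) : (forall x, ~ cells T x -> f x = 0) ->
  f = fun x => \sum_k (f \_ (osimplex (T k))) x.
Proof.
move=> f0; apply/funext => x; have [[k _ Tx]|nTx] := pselect (cells T x).
  rewrite (bigD1 k) //= patchE mem_set // big1 ?addr0 // => l lk.
  rewrite patchE memNset // => Tlx.
  suff : set0 x by []; by rewrite -(disjT lk).
rewrite f0 // big1 // => k _; rewrite patchE memNset // => Tx.
by apply: nTx; exists k.
Qed.

Lemma restrict_cell_bounded_measurable (f : 'rV[R]_n.+1 -> R) k :
  bounded_measurable (osimplex (T k)) f ->
  bounded_measurable Omega (f \_ (osimplex (T k))).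
Proof.
move=> [mf [B fB]]; split.
  apply: (measurable_restrict f (mcell k) mOmega).1.
  by apply: (measurable_funS (mcell k) _ mf) => x [].
exists `|B| => x _; rewrite patchE; case: ifPn => [/set_mem /fB|_].
  by move=> /le_trans; apply; exact: ler_norm.
by rewrite normr0.
Qed.

Lemma cells_bounded_measurable (f : 'rV[R]_n.+1 -> R) :
  (forall x, ~ cells T x -> f x = 0) ->
  (forall k, bounded_measurable (osimplex (T k)) f) -> bounded_measurable Omega f.
Proof.
move=> f0 bf; rewrite (restrict_cells f0); apply: bounded_measurable_sum => k.
exact: restrict_cell_bounded_measurable.
Qed.

Lemma Rintegral_cells (f : 'rV[R]_n.+1 -> R) :
  (forall x, ~ cells T x -> f x = 0) ->
  (forall k, bounded_measurable (osimplex (T k)) f) ->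
  \int[leb]_(x in Omega) f x = \sum_k \int[leb]_(x in osimplex (T k)) f x.
Proof.
move=> f0 bf; have bfk k := restrict_cell_bounded_measurable (bf k).
transitivity (\sum_k \int[leb]_(x in Omega) (f \_ (osimplex (T k))) x).
  rewrite [in LHS](restrict_cells f0); move: (index_enum _) => s.
  elim: s => [|k s IH].
    rewrite big_nil -[RHS](mul0r (fine (leb Omega))) -Rintegral_cst //.
    by apply: eq_Rintegral => x _; rewrite big_nil.
  rewrite big_cons -IH -[X in X + _]mul1r -(Rintegral_linear mOmega fOmega) //.
    by apply: eq_Rintegral => x _; rewrite big_cons mul1r.
  exact: bounded_measurable_sum.
apply: eq_bigr => k _; rewrite -Rintegral_mkcondr.
congr (Rintegral _ _ _); apply/seteqP; split => [x []|x Tx] //.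
by split=> //; exact: subT Tx.
Qed.

Lemma WG_zero_off_cells v : Vh v -> forall x, ~ cells T x -> v.1 x = 0.
Proof. by rewrite /WG_space => -[]. Qed.

Lemma b_h_L2E u v : Vh u -> Vh v -> b_h_L2 Omega u.1 v = b_h T u v.
Proof.
move=> Vu Vv; apply: Rintegral_cells.
  by move=> x /(WG_zero_off_cells Vu) ->; rewrite mul0r.
by move=> k; apply: bounded_measurableM; exact: WG_bounded_measurable.
Qed.

Lemma WG_bounded_measurable_domain v : Vh v -> bounded_measurable Omega v.1.
Proof.
move=> Vv; apply: cells_bounded_measurable; first exact: WG_zero_off_cells.
by move=> k; exact: WG_bounded_measurable.
Qed.

Lemma WG_L2 v : Vh v -> L2 Omega v.1.
Proof.
move=> /WG_bounded_measurable_domain bv; split; first by case: bv.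
apply: (bounded_measurable_integrable mOmega fOmega (f := fun x => v.1 x ^+ 2)).
exact: bounded_measurableM.
Qed.

Lemma L2norm_WG v : Vh v -> L2norm Omega v.1 = Num.sqrt (b_h T v v).
Proof. by move=> Vv; rewrite /L2norm -b_h_L2E. Qed.

Lemma b_h_L2_young f v s : L2 Omega f -> Vh v -> 0 < s ->
  b_h_L2 Omega f v <= (s * L2norm Omega f ^+ 2 + s^-1 * b_h T v v) / 2.
Proof.
move=> [mf intf] Vv s0; have bv := WG_bounded_measurable_domain Vv.
have intv : leb.-integrable Omega (EFin \o (fun x => v.1 x * v.1 x)).
  by apply: bounded_measurable_integrable => //; exact: bounded_measurableM.
have intk (k : R) (g : 'rV[R]_n.+1 -> R) : leb.-integrable Omega (EFin \o g) ->
    leb.-integrable Omega (EFin \o (fun x => k * g x)).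
  by move=> ig; exact: (integrableZl mOmega k ig).
have intD (g h : 'rV[R]_n.+1 -> R) : leb.-integrable Omega (EFin \o g) ->
    leb.-integrable Omega (EFin \o h) ->
    leb.-integrable Omega (EFin \o (fun x => g x + h x)).
  by move=> ig ih; exact: (integrableD mOmega ig ih).
pose F x := s / 2 * f x ^+ 2 + s^-1 / 2 * (v.1 x * v.1 x).
have intF : leb.-integrable Omega (EFin \o F) by apply: intD; apply: intk.
have young (y z : R) : y * z <= s / 2 * y ^+ 2 + s^-1 / 2 * (z * z).
  rewrite -subr_ge0 (_ : _ - _ = s^-1 / 2 * (s * y - z) ^+ 2); last first.
    by field; exact: lt0r_neq0.
  by rewrite mulr_ge0 ?sqr_ge0 // divr_ge0 // invr_ge0 ltW.
have intfv : leb.-integrable Omega (EFin \o (fun x => f x * v.1 x)).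
  apply: le_integrable intF => //.
    by apply/measurable_EFinP/measurable_funM => //; case: bv.
  move=> x _; rewrite /= lee_fin ler_norml; apply/andP; split.
    rewrite lerNl; apply: le_trans (ler_norm _); rewrite -mulNr.
    by apply: le_trans (young _ _) _; rewrite sqrrN.
  by apply: le_trans (ler_norm _); exact: young.
have -> : (s * L2norm Omega f ^+ 2 + s^-1 * b_h T v v) / 2 =
    \int[leb]_(x in Omega) F x.
  rewrite RintegralD //; [|exact: intk..].
  rewrite !RintegralZl // -/(b_h_L2 Omega v.1 v) b_h_L2E // sqr_sqrtr.
    by field; exact: lt0r_neq0.
  by apply: Rintegral_ge0 => x _; exact: sqr_ge0.
by apply: le_Rintegral => // x _; exact: young.
Qed.

End weak_galerkin_forms.

(** * Spectral decompositions and the theorem *)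

Section eigensystems.
Context {R : realType} {V : lmodType R}.

Lemma has_dim_span (W : set V) N (x : 'I_N -> V) : has_dim W N ->
  (forall j, W (x j)) ->
  (forall c : 'I_N -> R, \sum_j c j *: x j = 0 -> forall j, c j = 0) ->
  forall v, W v -> in_span x v.
Proof.
move=> [e [We _ gen]] Wx ind v Wv.
have [c cE] := choice (fun j => gen _ (Wx j)).
pose M : 'M[R]_N := \matrix_(j, k) c j k.
have comb (y : 'rV[R]_N) :
    \sum_j y 0 j *: x j = \sum_k (y *m M) 0 k *: e k.
  under eq_bigr => j _ do rewrite cE scaler_sumr.
  rewrite exchange_big; apply: eq_bigr => k _ /=.
  rewrite mxE scaler_suml; apply: eq_bigr => j _.
  by rewrite mxE scalerA.
have unitM : M \in unitmx.
  rewrite -row_free_unit -kermx_eq0; apply/rowV0P => y /sub_kermxP yM.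
  apply/rowP => j; rewrite [RHS]mxE; apply: (ind (y 0)).
  by rewrite comb yM big1 // => k _; rewrite mxE scale0r.
have [d ->] := gen _ Wv; exists (fun j => (\row_k d k *m invmx M) 0 j).
by rewrite comb mulmxKV //; apply: eq_bigr => k _; rewrite mxE.
Qed.

Lemma recipK (mu : R) : erecip (recip mu) = mu.
Proof. by rewrite /recip; case: eqP => [->|_] //=; rewrite invrK. Qed.

Lemma erecip_le (x y : \bar R) : (0 < x)%E -> (x <= y)%E ->
  0 <= erecip y <= erecip x.
Proof.
case: x => [x||] // x0; case: y => [y||] //= xy.
- rewrite lte_fin in x0; rewrite lee_fin in xy.
  have y0 := lt_le_trans x0 xy.
  by rewrite invr_ge0 (ltW y0) lef_pV2.
- by rewrite lexx invr_ge0 ltW.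
- by rewrite lexx.
Qed.

Variables (S W : set V) (a b : V -> V -> R) (N : nat).
Variables (lam : nat -> \bar R) (u : nat -> V).
Hypotheses (hS : linear_subspace S) (ha : psd_form S a) (hb : psd_form S b).
Hypotheses (WS : W `<=` S) (dimW : has_dim W N) (eig : eigensystem a b W N lam u).

(* Eigenpairs are numbered from 1, ordinals from 0. *)
Definition eigvec (j : 'I_N) : V := u j.+1.
Definition eigmu (j : 'I_N) : R := erecip (lam j.+1).

Lemma eigvec_in j : W (eigvec j).
Proof. by case: eig => /(_ j.+1 (ltn_ord j))[]. Qed.

Lemma eigvecS j : S (eigvec j).
Proof. exact/WS/eigvec_in. Qed.

Lemma eigvec_orth p q : a (eigvec p) (eigvec q) = (p == q)%:R.
Proof.
by case: eig => _ /(_ p.+1 q.+1 (ltn_ord p) (ltn_ord q)) -> _; rewrite eqSS.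
Qed.

Lemma eigvec_eigen j v : W v -> b (eigvec j) v = eigmu j * a (eigvec j) v.
Proof.
case: eig => /(_ j.+1 (ltn_ord j))[_ _ [mu [lamE bE]]] _ _.
by rewrite /eigmu lamE recipK; exact: bE.
Qed.

Lemma eigvec_span v : W v -> in_span eigvec v.
Proof.
apply: (has_dim_span dimW eigvec_in) => c c0 j.
rewrite -(form_comb hS ha eigvecS eigvec_orth c j) c0.
exact: (psd0l hS ha (eigvecS j)).
Qed.

Lemma eigmu_bound : (0 < lam 1%N)%E -> forall v, W v ->
  b v v <= erecip (lam 1%N) * a v v.
Proof.
move=> lam0 v Wv; have [c vE] := eigvec_span Wv.
have Sv := WS Wv.
rewrite {2 4}vE (form_sumr hS ha) ?(form_sumr hS hb) //; try exact: eigvecS.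
rewrite mulr_sumr; apply: ler_sum => j _.
rewrite (form_sym hb Sv (eigvecS j)) eigvec_eigen // (form_sym ha (eigvecS j) Sv).
have -> : a v (eigvec j) = c j.
  by rewrite {1}vE (form_comb hS ha eigvecS eigvec_orth).
rewrite [leLHS](_ : _ = eigmu j * (c j ^+ 2)); last by ring.
rewrite [leRHS](_ : _ = erecip (lam 1%N) * (c j ^+ 2)); last by ring.
apply: ler_wpM2r; first exact: sqr_ge0.
case: eig => _ _ /(_ 1%N j.+1 isT isT (ltn_ord j)) /(erecip_le lam0).
by case/andP.
Qed.

Lemma eigsys_definite v : W v -> v != 0 -> 0 < a v v.
Proof.
move=> Wv v0; rewrite lt_def (form_ge0 ha (WS Wv)) andbT.
apply: contra v0; have [c vE] := eigvec_span Wv.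
rewrite {1 2}vE (form_comb_sq hS ha eigvecS eigvec_orth) psumr_eq0; last first.
  by move=> j _; exact: sqr_ge0.
move=> /allP c0; rewrite vE big1 // => j _.
have := c0 j (mem_index_enum _); rewrite /= sqrf_eq0 => /eqP ->.
by rewrite scale0r.
Qed.

End eigensystems.

Lemma spectral_gap_bound (R : realType) N i (lam : nat -> \bar R) (lamb : R) :
  (0 < spectral_gap N i lam lamb)%E ->
  0 <= erecip (spectral_gap N i lam lamb) /\
  forall j, (1 <= j <= N)%N -> j != i ->
    1 <= erecip (spectral_gap N i lam lamb) * `|erecip (lam j) - lamb^-1|.
Proof.
set d := spectral_gap _ _ _ _ => d0; split.
  by case: d d0 => //= d; rewrite lte_fin => d0; rewrite invr_ge0 ltW.
move=> j jN ji; have : (d <= (`|erecip (lam j) - lamb^-1|)%:E)%E.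
  apply: (@ge_bigmin_seq _ _ _ _ _ j) => //.
  by rewrite mem_index_iota ltnS.
case: d d0 => //= d; rewrite lte_fin lee_fin => d0 dj.
by rewrite mulrC ler_pdivlMr // mul1r.
Qed.

Section embedding.
Variables (R : realType) (n m M : nat) (Omega : set 'rV[R]_n.+1).
Variables (Th : mesh R n m) (TH : mesh R n M).

Lemma embedded_FE_space0 : [set embed Th w | w in FE_space Omega TH] 0.
Proof.
exists (fun=> 0).
  by split=> //; [exact: cst_continuous|move=> k; exact: poly_on0].
by congr pair; apply/funext => x; rewrite patchE; case: ifP.
Qed.

End embedding.

Section eta.
Variables (R : realType) (n : nat) (Omega : set 'rV[R]_n.+1).
Variables (Vh : set (wfun R n)) (a b : wfun R n -> wfun R n -> R) (mu1 : R).
Hypotheses (hV : linear_subspace Vh) (ha : psd_form Vh a) (hb : psd_form Vh b).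
Hypotheses (mu1_ge0 : 0 <= mu1) (b_le : forall v, Vh v -> b v v <= mu1 * a v v).
Hypothesis L2V : forall v, Vh v -> L2 Omega v.1.
Hypothesis normV : forall v, Vh v -> L2norm Omega v.1 = Num.sqrt (b v v).
Hypothesis b_L2 : forall u v, Vh u -> Vh v -> b_h_L2 Omega u.1 v = b u v.
Hypothesis young : forall f v s, L2 Omega f -> Vh v -> 0 < s ->
  b_h_L2 Omega f v <= (s * L2norm Omega f ^+ 2 + s^-1 * b v v) / 2.
Variables (Tsol : ('rV[R]_n.+1 -> R) -> wfun R n) (W : set (wfun R n)).
Hypothesis hTsol : forall f, L2 Omega f -> Vh (Tsol f) /\
     forall v, Vh v -> a (Tsol f) v = b_h_L2 Omega f v.
Hypotheses (WV : W `<=` Vh) (W0 : W 0).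

Lemma solution_bounded f : L2 Omega f -> L2norm Omega f = 1 ->
  form_norm a (Tsol f) <= Num.sqrt (1 + mu1).
Proof.
move=> L2f f1; have [VT TE] := hTsol L2f; apply: ler_wsqrtr.
have s0 : 0 < 1 + mu1 by rewrite ltr_wpDr.
have := young L2f VT s0; rewrite -TE // f1 expr1n mulr1.
set A := a _ _; have A0 : 0 <= A by exact: (form_ge0 ha).
have : (1 + mu1)^-1 * b (Tsol f) (Tsol f) <= A.
  rewrite mulrC ler_pdivrMr //; apply: le_trans (b_le VT) _.
  by rewrite mulrC ler_wpM2l // lerDr.
by move: (_ * b _ _) => B; lra.
Qed.

Let dist f := [set form_norm a (Tsol f - w) | w in W].
Let values :=
  [set s | exists f, [/\ L2 Omega f, L2norm Omega f = 1 & s = inf (dist f)]].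

Let dist_ge0 f : lbound (dist f) 0.
Proof. by move=> _ [w _ <-]; exact: sqrtr_ge0. Qed.

Let dist_neq0 f : dist f !=set0.
Proof. by exists (form_norm a (Tsol f - 0)), 0. Qed.

(* Needed because [sup] of an unbounded set is [0]. *)
Let values_ubound : has_ubound values.
Proof.
exists (Num.sqrt (1 + mu1)) => _ [f [L2f f1 ->]].
apply: le_trans (solution_bounded L2f f1).
apply: ge_inf; first by exists 0; exact: dist_ge0.
by exists 0 => //; rewrite subr0.
Qed.

Lemma eta_a_ge0 : 0 <= eta_a Omega a Tsol W.
Proof.
rewrite /eta_a -/values; have [[s Vs]|/set0P/negP/negPn/eqP ->] :=
  pselect (values !=set0); last by rewrite sup0.
apply: le_trans (ub_le_sup values_ubound Vs).
by case: Vs => f [_ _ ->]; exact: lb_le_inf (dist_neq0 f) (@dist_ge0 f).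
Qed.

Lemma eta_a_approx f g : Vh f -> Vh g -> (forall v, Vh v -> a g v = b f v) ->
  b f f = 1 -> forall k, eta_a Omega a Tsol W < k ->
  exists w, W w /\ Num.sqrt (a (g - w) (g - w)) < k.
Proof.
move=> Vf Vg gE f1 k etak; have [VT TE] := hTsol (L2V Vf).
have : inf (dist f.1) <= eta_a Omega a Tsol W.
  apply: (ub_le_sup values_ubound); exists f.1.
  by rewrite normV // f1 sqrtr1; split=> //; exact: L2V.
move=> /le_lt_trans/(_ etak)/(inf_lt (dist_neq0 _))[_ [w Ww <-] wk].
exists w; split=> //; have Vw := WV Ww.
have Vd := linear_subspaceB hV Vg VT; have VTw := linear_subspaceB hV VT Vw.
have d0 v : Vh v -> a (g - Tsol f.1) v = 0.
  by move=> Vv; rewrite (psdBl hV ha) // gE // TE // b_L2 // subrr.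
rewrite -(subrKA (Tsol f.1) g) (psdDD hV ha Vd VTw) !d0 //.
by rewrite mulr0 !add0r.
Qed.

End eta.

Lemma bounded_set_box (R : realType) n (D : set 'rV[R]_n) :
  bounded_set D -> exists B, D `<=` box B.
Proof.
move=> [B [_ DB]]; exists (B + 1) => x Dx i.
apply: le_trans (DB (B + 1) _ x Dx); last by rewrite ltrDl.
by rewrite [leRHS]/Num.Def.normr /= mx_normrE; exact: (le_bigmax _ _ (ord0, i)).
Qed.

Theorem theorem3p2 (R : realType) (n : nat) (hd : n.+1 = 2%N \/ n.+1 = 3%N)
  (Omega : set 'rV[R]_n.+1) (hOmega : convex_polyhedral_domain Omega)
  (A : 'rV[R]_n.+1 -> 'M[R]_n.+1) (c C : R) (hA : coefficient Omega A c C)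
  (m : nat) (Th : mesh R n m) (hTh : triangulation Omega Th)
  (sigma : R) (hreg : shape_regular sigma Th) (hqu : quasi_uniform sigma Th)
  (r t : nat) (ht : t = r \/ t = r.+1)
  (gradw : wfun R n -> 'rV[R]_n.+1 -> 'rV[R]_n.+1)
  (hgradw : forall v, WG_space Omega Th r t v ->
     weak_gradient Th r t v (gradw v)) :
  let Vh := WG_space Omega Th r t in
  let a := a_h Th A gradw in
  let b := b_h Th in
  forall
  (Nh : nat) (hNh : has_dim Vh Nh)
  (lamh : nat -> \bar R) (uh : nat -> wfun R n)
  (huh : eigensystem a b Vh Nh lamh uh) (hlamh : (0 < lamh 1%N)%E)
  (M : nat) (TH : mesh R n M) (hTH : triangulation Omega TH)
  (hnest : nested Th TH),
  let WH := [set embed Th w | w in FE_space Omega TH] in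
  forall (NH : nat) (hNH : has_dim WH NH) (hWV : WH `<=` Vh)
  (Tsol : ('rV[R]_n.+1 -> R) -> wfun R n)
  (hTsol : forall f, L2 Omega f -> Vh (Tsol f) /\
     forall v, Vh v -> a (Tsol f) v = b_h_L2 Omega f v),
  let eta := eta_a Omega a Tsol WH in
  forall
  (uhat : nat -> wfun R n) (lam : nat -> nat -> \bar R)
  (u : nat -> nat -> wfun R n) (i : nat -> nat),
  let V l := add_span WH (uhat l) in
  forall
  (huhat1 : Vh (uhat 1%N))
  (hdimV : forall l, (1 <= l)%N -> has_dim (V l) NH.+1)
  (hu : forall l, (1 <= l)%N -> eigensystem a b (V l) NH.+1 (lam l) (u l))
  (hi : forall l, (1 <= l)%N -> (1 <= i l <= NH.+1)%N)
  (hfin : forall l, (1 <= l)%N -> (lam l (i l) < +oo)%E)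
  (hsel : forall l, (2 <= l)%N ->
     largest_component WH (uhat l) NH.+1 (i l) (lam l) (u l))
  (huhat : forall l, (1 <= l)%N -> Vh (uhat l.+1) /\
     forall v, Vh v -> a (uhat l.+1) v = fine (lam l (i l)) * b (u l (i l)) v)
  (lamb : R) (ub : wfun R n) (hub : eigenpair a b Vh lamb%:E ub)
  (hclosest : forall l, (1 <= l)%N -> forall j, (1 <= j <= NH.+1)%N ->
     `|erecip (lam l (i l)) - lamb^-1| <= `|erecip (lam l j) - lamb^-1|)
  (E : nat -> wfun R n -> wfun R n)
  (hE : forall l, (1 <= l)%N -> forall w, Vh w ->
     (exists k, E l w = k *: u l (i l)) /\
     a (E l w) (u l (i l)) = a w (u l (i l))),
  let delta l := spectral_gap NH.+1 (i l) (lam l) lamb in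
  forall (hdelta : forall l, (1 <= l)%N -> (0 < delta l)%E) (l : nat),
  (1 <= l)%N ->
  form_norm a (ub - E l.+1 ub) <=
    lamb
    * Num.sqrt (1 + eta ^+ 2 * erecip (lamh 1%N) * erecip (delta l.+1) ^+ 2)
    * (1 + erecip (lamh 1%N) * erecip (delta l))
    * eta ^+ 2 * form_norm a (ub - E l ub).
Proof.
move=> Vh a b Nh hNh lamh uh huh hlamh M TH hTH _ WH NH _ hWV Tsol hTsol eta.
move=> uhat lam u i V huhat1 hdimV hu hi hfin _ huhat lamb ub hub _ E hE delta.
move=> hdelta l l1.
have freeT k : row_free (edge_mx (Th k)) by case: hTh.
have subT k := osimplex_sub_domain (k := k) hOmega hTh.
have disjT k k' : k != k' -> osimplex (Th k) `&` osimplex (Th k') = set0.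
  by case: hTh => _ _ + _; apply.
have mOmega : measurable Omega.
  by case: hOmega => _ _ [p [N [d ->]]]; exact: measurable_polyhedron.
have bOmega : exists B, Omega `<=` box B.
  by case: hOmega => _ + _; exact: bounded_set_box.
have hV : linear_subspace Vh by exact: WG_subspace.
have ha : psd_form Vh a.
  exact: (a_h_form freeT hgradw hA subT mOmega).
have hb : psd_form Vh b by exact: b_h_form.
pose mu1 := erecip (lamh 1%N).
have mu1_ge0 : 0 <= mu1 by case/andP: (erecip_le hlamh (lexx _)).
have VV : Vh `<=` Vh by [].
have b_le v : Vh v -> b v v <= mu1 * a v v.
  exact: (eigmu_bound hV ha hb VV hNh huh hlamh).
have WH0 : WH 0 by exact: embedded_FE_space0.
have L2V v : Vh v -> L2 Omega v.1.
  exact: (WG_L2 freeT mOmega bOmega disjT).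
have normV v : Vh v -> L2norm Omega v.1 = Num.sqrt (b v v).
  exact: (L2norm_WG freeT subT mOmega bOmega disjT).
have b_L2 v w : Vh v -> Vh w -> b_h_L2 Omega v.1 w = b v w.
  exact: (b_h_L2E freeT subT mOmega bOmega disjT).
have young f v s : L2 Omega f -> Vh v -> 0 < s ->
    b_h_L2 Omega f v <= (s * L2norm Omega f ^+ 2 + s^-1 * b v v) / 2.
  exact: (b_h_L2_young freeT subT mOmega bOmega disjT).
have eta_ge0 : 0 <= eta.
  exact: (eta_a_ge0 ha mu1_ge0 b_le young hTsol WH0).
have approx := eta_a_approx hV ha mu1_ge0 b_le L2V normV b_L2 young hTsol hWV WH0.
have solvable f : Vh f -> exists g, Vh g /\ forall v, Vh v -> a g v = b f v.
  move=> Vf; have [VT TE] := hTsol _ (L2V _ Vf); exists (Tsol f.1).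
  by split=> // v Vv; rewrite TE // b_L2.
have Vuhat k : (1 <= k)%N -> Vh (uhat k).
  by case: k => // -[|k] // _; case: (huhat k.+1 isT).
have VlV k : (1 <= k)%N -> V k `<=` Vh.
  move=> k1 _ [w [s [Ww ->]]]; apply: (linear_subspaceD hV); first exact: hWV.
  exact/(linear_subspaceZ hV)/Vuhat.
have WVl k : WH `<=` V k.
  by move=> w Ww; exists w, 0; split=> //; rewrite scale0r addr0.
have [Vub ub0 [mub [lambE ubE]]] := hub.
have mub0 : mub != 0 by apply/eqP => mub0; move: lambE; rewrite /recip mub0 eqxx.
have {lambE} lambE : lamb = mub^-1.
  by move: lambE; rewrite /recip (negbTE mub0) => -[].
have aub := eigsys_definite hV ha VV hNh huh Vub ub0.
have lamb0 : 0 < lamb.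
  rewrite lambE invr_gt0 lt_def mub0 -(pmulr_lge0 _ aub) -ubE //.
  exact: (form_ge0 hb).
have ubE' v : Vh v -> b ub v = lamb^-1 * a ub v.
  by rewrite lambE invrK; exact: ubE.
have pos_ord k : (1 <= k)%N -> {j : 'I_NH.+1 | j.+1 = i k}.
  move=> k1; have /andP[ik1 ik2] := hi k k1.
  have ltj : ((i k).-1 < NH.+1)%N by rewrite prednK.
  by exists (Ordinal ltj); rewrite /= prednK.
have l1' : (1 <= l.+1)%N by [].
have [j jE] := pos_ord l l1; have [j' jE'] := pos_ord l.+1 l1'.
have [gap0 gap] := spectral_gap_bound (hdelta l l1).
have [gap0' gap'] := spectral_gap_bound (hdelta l.+1 l1').
have [_ _ [muj [lamjE _]]] : eigenpair a b (V l) (lam l (i l)) (u l (i l)).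
  by case: (hu l l1) => + _ _; apply; exact: hi.
have muj0 : muj != 0.
  by apply/eqP => muj0; have := hfin l l1; rewrite lamjE /recip muj0 eqxx ltxx.
have lami0 : fine (lam l (i l)) != 0.
  by rewrite lamjE /recip (negbTE muj0) /= invr_eq0.
have [_ uhatE] := huhat l l1.
have EE k (k1 : (1 <= k)%N) (p : 'I_NH.+1) : p.+1 = i k ->
    E k ub = a ub (eigvec (u k) p) *: eigvec (u k) p.
  move=> pE; have [[s ->]] := hE k k1 ub Vub.
  have := eigvec_orth (hu k k1) p p.
  rewrite eqxx /eigvec pE => app.
  have Vu : Vh (u k (i k)).
    by rewrite -pE; exact: (eigvecS (VlV k k1) (hu k k1) p).
  by rewrite (psdZl hV ha) // app mulr1 => ->.
rewrite /form_norm.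
apply: (@augmented_subspace_step _ _ Vh a b _ _ (eigvec (u l)) (eigvec (u l.+1))
  mu1 eta WH (eigmu (lam l)) (eigmu (lam l.+1)) j j' _ _ _
  (fine (lam l (i l))) ub (uhat l.+1)) => //.
- exact: (eigvecS (VlV l l1) (hu l l1)).
- exact: (eigvecS (VlV l.+1 l1') (hu l.+1 l1')).
- exact: (eigvec_orth (hu l l1)).
- exact: (eigvec_orth (hu l.+1 l1')).
- move=> w /(WVl l).
  exact: (eigvec_span hV ha (VlV l l1) (hdimV l l1) (hu l l1)).
- move=> w /(WVl l.+1).
  exact: (eigvec_span hV ha (VlV l.+1 l1') (hdimV l.+1 l1') (hu l.+1 l1')).
- move=> p q; apply: (eigvec_eigen (hu l l1)).
  exact: (eigvec_in (hu l l1)).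
- move=> p q; apply: (eigvec_eigen (hu l.+1 l1')).
  exact: (eigvec_in (hu l.+1 l1')).
- move=> p pj; apply: gap; first exact: ltn_ord.
  by rewrite -jE eqSS.
- move=> p pj; apply: gap'; first exact: ltn_ord.
  by rewrite -jE' eqSS.
- exact: Vuhat.
- apply: (eigvec_span hV ha (VlV l.+1 l1') (hdimV l.+1 l1') (hu l.+1 l1')).
  by exists 0, 1; split=> //; rewrite scale1r add0r.
- by rewrite /eigvec jE.
- exact: EE.
- exact: EE.
Qed.
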